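(* In the setting of the context (Gaussian noise of scale $\epsilon$), let $u\in\mathcal B_R$ be the initial position and for $k\in\mathbb N$ let $$S_J(u,k)=\{v\in\mathbb R^d:\det(J\Psi_{t_k}(v))=\det(J\Psi_{t_k}(u))\}.$$ Suppose that for every $k\in\mathbb N$ there is a set $\tilde U(u,k)\subset S_J(u,k)$ (anti-leaf set) and constants $C^{(2)}_{\tilde U}(u,k)$, $\tilde d^{(2)}_{\max}(u,k)$ such that $\{\|v(t_k)-u(t_k)\|_2: v\in\tilde U(u,k)\}=[0,\tilde d^{(2)}_{\max}(u,k)]$ and for every $v\in\tilde U(u,k)$, $$\sum_{i=0}^k\|\Psi_{t_i}(v)-\Psi_{t_i}(u)\|_2^2\le C^{(2)}_{\tilde U}(u,k)\cdot\|v(t_k)-u(t_k)\|_2^2,$$ and that there are infinitely many indices $i_1<i_2<\ldots$ such that for every $i_j$, $C^{(2)}_{\tilde U}(u,i_j)\le C^{(2)}_{\tilde U}(u)$ and $\tilde d^{(2)}_{\max}(u,i_j)\ge\tilde d^{(2)}_{\max}(u)$ for some constants $C^{(2)}_{\tilde U}(u)<\infty$ and $\tilde d^{(2)}_{\max}(u)>0$. Suppose that the density of the prior $q$ is continuous at the point $u$, and $q(v)>0$ for every $v\in\bigcup_{k\in\mathbb N}\tilde U(u,k)$. Then for $\epsilon>0$ sufficiently small, for any $j\ge1$, $$\mathbb E\left[\left.\mathrm{diam}_2\left\{v\in\mathbb R^d:\frac{\mu^{\mathrm{fi}}(v|Y_0,\ldots,Y_{i_j})}{\mu^{\mathrm{fi}}(u(t_{i_j})|Y_0,\ldots,Y_{i_j})}\ge\frac1e\right\}\right|u\right]\ge\frac{1}{2\|H\|_2\sqrt{C^{(2)}_{\tilde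 U}(u)}}\cdot\epsilon,$$ where $\mathrm{diam}_2$ denotes the diameter with respect to the Euclidean distance.
   Context: Dynamics: $\frac{du}{dt}=-Au-B(u,u)+f$ on $\mathbb R^d$, with $A$ a linear operator, $B:\mathbb R^d\times\mathbb R^d\to\mathbb R^d$ bilinear, $f\in\mathbb R^d$. For $v\in\mathbb R^d$, $v(t)=\Psi_t(v)$ is the solution with $v(0)=v$. Trapping ball assumption: there are $R,\delta>0$ with $\langle -Av-B(v,v)+f,v\rangle\le0$ whenever $\|v\|\in[R,R+\delta]$. $\mathcal B_R=\{v:\|v\|\le R\}$; for $v\in\mathcal B_R$ the solution exists for all $t\ge0$ and stays in $\mathcal B_R$, and $\Psi_t$ is one-to-one from $\mathcal B_R$ onto $\Psi_t(\mathcal B_R)$ with inverse denoted $\Psi_{-t}$. $J\Psi_t(v)$ denotes the $d\times d$ Jacobian matrix of $\Psi_t$ at $v$. Observations: $t_i=ih$ with fixed $h>0$, $Y_i=Hu(t_i)+Z_i$, $H\in\mathbb R^{d_o\times d}$ nonzero, $Z_i$ i.i.d. such that $Z_i/\epsilon$ has the $d_o$-dimensional standard Gaussian distribution; $\eta$ is the density of $Z_i$. The prior $q$ is a probability density on $\mathbb R^d$ vanishing outside $\mathcal B_R$. The filtering density is $\mu^{\mathrm{fi}}(v|Y_0,\ldots,Y_k)\propto\left[\prod_{i=0}^k\eta(Y_i-H\Psi_{t_i-t_k}(v))\right]\det(J\Psi_{-t_k}(v))\,q(\Psi_{-t_k}(v))$ for $v\in\Psi_{t_k}(\mathcal B_R)$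 (with $\Psi_{t_i-t_k}(v)=\Psi_{t_i}(\Psi_{-t_k}(v))$), and $0$ otherwise. $\mathbb E[\cdot|u]$ is expectation over the noise with true initial point $u$. $\|H\|_2$ is the operator norm induced by the Euclidean norm. *)

(* Defs.v *)
From HB Require Import structures.
From mathcomp Require Import all_boot all_order all_algebra sesquilinear.
From mathcomp Require Import all_classical all_reals all_analysis.
From mathcomp Require Import measurable_realfun.
From mathcomp Require Import ring lra.

Set Implicit Arguments.
Unset Strict Implicit.
Unset Printing Implicit Defensive.

Import Order.TTheory GRing.Theory Num.Theory.
Import numFieldNormedType.Exports.

Local Open Scope classical_set_scope.
Local Open Scope ring_scope.

(* Vectors of R^n are row vectors.  The norm `|v| of the library on 'rV[R]_n is
   the sup norm: it is only used for the topology, all distances below are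
   Euclidean. *)
Section euclid.
Context {R : realType}.

Definition dot2 n (u v : 'rV[R]_n) : R := \sum_(i < n) u 0 i * v 0 i.

Definition norm2 n (v : 'rV[R]_n) : R := Num.sqrt (dot2 v v).

Definition ball2 n (r : R) : set 'rV[R]_n := [set v | norm2 v <= r].

(* \bar R-valued; the [maxe 0] makes the diameter of the empty set 0. *)
Definition diam2 n (S : set 'rV[R]_n) : \bar R :=
  maxe 0%E (ereal_sup [set (norm2 (p.1 - p.2))%:E | p in S `*` S]).

(* The matrix M acts on the row vector v by v |-> v *m M^T, the transpose of
   the usual product of M with a column vector. *)
Definition mxapp m n (M : 'M[R]_(m, n)) (v : 'rV[R]_n) : 'rV[R]_m := v *m M^T.

Definition opnorm2 m n (M : 'M[R]_(m, n)) : R :=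
  sup [set norm2 (mxapp M v) | v in ball2 1].

End euclid.

Definition borel (R : realType) n := g_sigma_algebraType (@open 'rV[R]_n).


Section borel_theory.
Context {R : realType}.

Lemma borel_rat_box n (U : set 'rV[R]_n) v : open U -> U v ->
  exists (q : 'rV[rat]_n) (m : nat),
    ball (map_mx ratr q : 'rV[R]_n) m.+1%:R^-1 v /\
    ball (map_mx ratr q : 'rV[R]_n) m.+1%:R^-1 `<=` U.
Proof.
move=> oU Uv.
have /nbhs_ballP[e /= e0 veU] : nbhs v U by exact: open_nbhs_nbhs.
have [m em] : exists m : nat, m.+1%:R^-1 < e / 2.
  exists (Num.truncn (e / 2)^-1).
  rewrite invf_plt ?posrE ?divr_gt0//; exact: truncnS_gt.
have m0 : 0 < m.+1%:R^-1 :> R by [].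
have qx i : exists q : rat, ratr q \in `](v 0 i - m.+1%:R^-1), (v 0 i + m.+1%:R^-1)[.
  by apply: rat_in_itvoo; rewrite ltrBlDr -addrA ltrDl addr_gt0.
pose q : 'rV[rat]_n := \row_i projT1 (cid (qx i)).
have qv : ball (map_mx ratr q : 'rV[R]_n) m.+1%:R^-1 v.
  split=> // i j; rewrite !mxE ord1; case: cid => r /=.
  by rewrite in_itv/= => /andP[h1 h2]; rewrite /ball/= ltr_distlC; apply/andP; split; move: h1 h2; set a := v _ _; set b := ratr r; set c := _^-1 => h1 h2; lra.
exists q, m; split=> // w qw; apply: veU.
apply: (@le_ball _ _ v (m.+1%:R^-1 + m.+1%:R^-1)).
  by rewrite [leRHS]splitr lerD// ltW.
apply: ball_triangle qw; exact: ball_sym.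
Qed.

Lemma measurable_fun_borel d (T : measurableType d) n (f : T -> borel R n) :
  (forall i, measurable_fun [set: T] (fun x => (f x : 'rV[R]_n) 0 i)) ->
  measurable_fun [set: T] f.
Proof.
move=> mf; apply: (@measurability _ _ T (borel R n) setT f (@open 'rV[R]_n) erefl).
move=> _ [U oU <-]; rewrite setTI.
pose I : set ('rV[rat]_n * nat) :=
  [set p | ball (map_mx ratr p.1 : 'rV[R]_n) p.2.+1%:R^-1 `<=` U].
pose F (p : 'rV[rat]_n * nat) : set T :=
  if pselect (I p) then
    \bigcap_(i : 'I_n) ((fun x => (f x : 'rV[R]_n) 0 i) @^-1`
      (ball (ratr (p.1 0 i) : R) p.2.+1%:R^-1))
  else set0.
rewrite (_ : f @^-1` U = \bigcup_p F p).
  apply: countable_bigcupT_measurable => [|p]; first exact: countableP.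
  rewrite /F.
  case: pselect => //= _.
  apply: fin_bigcap_measurable => //= i _.
  rewrite -[X in measurable X]setTI.
  apply: mf => //; apply: open_measurable; exact: ball_open.
apply/seteqP; split=> [x /= Ux|x /= [[q m] _]].
  have [q [m [qx qU]]] := borel_rat_box oU Ux.
  exists (q, m) => //; rewrite /F; case: pselect => //= _.
  move=> i _ /=.
  case: qx => _ /(_ 0 i); by rewrite mxE.
rewrite /F; case: pselect => //= IU.
move=> /= h; apply: IU; split=> // i j.
by rewrite mxE ord1; exact: (h j).
Qed.

Lemma measurable_borel_coord n (i : 'I_n) :
  measurable_fun [set: borel R n] (fun v : borel R n => (v : 'rV[R]_n) 0 i).
Proof.
apply: (@measurability _ _ _ _ _ _ (@RGenOpens.G R)).
  exact: RGenOpens.measurableE.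
move=> _ [_ [x [y ->]] <-]; rewrite setTI; apply: sub_sigma_algebra.
apply: (@open_comp 'rV[R]_n R (fun v => v 0 i)) => [v _|]; last exact: itv_open.
exact: coord_continuous.
Qed.

End borel_theory.

Section lebesgue_rV.
Context {R : realType}.

Definition cons_rV n (p : measurableTypeR R * borel R n) : borel R n.+1 :=
  row_mx (const_mx p.1 : 'rV[R]_1) (p.2 : 'rV[R]_n).

Lemma measurable_cons_rV n : measurable_fun setT (@cons_rV n).
Proof.
apply: measurable_fun_borel => i.
have [j ij|j ij] := split_ordP (i : 'I_(1 + n)).
  rewrite (_ : (fun p => _) = fst); first exact: measurable_fst.
  by apply/funext => p; rewrite ij [LHS]row_mxEl mxE.
rewrite (_ : (fun p => _) = (fun v : borel R n => (v : 'rV[R]_n) 0 j) \o snd).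
  apply: (measurableT_comp (measurable_borel_coord j)); exact: measurable_snd.
by apply/funext => p; rewrite ij [LHS]row_mxEr.
Qed.

Section step.
Variables (n : nat) (m : {sigma_finite_measure set (borel R n) -> \bar R}).

Definition lebesgue_cons : set (borel R n.+1) -> \bar R :=
  pushforward (@lebesgue_measure R \x m)%E (@cons_rV n).

Let lebesgue_cons0 : lebesgue_cons set0 = 0%E.
Proof. by rewrite /lebesgue_cons /pushforward preimage_set0 measure0. Qed.

Let lebesgue_cons_ge0 A : (0 <= lebesgue_cons A)%E.
Proof. by rewrite /lebesgue_cons /pushforward; exact: (measure_ge0 (@lebesgue_measure R \x m)%E). Qed.

Let lebesgue_cons_sigma_additive : semi_sigma_additive lebesgue_cons.
Proof.
move=> F mF tF mUF.
have mcons A : measurable A -> measurable (@cons_rV n @^-1` A).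
  by move=> mA; rewrite -[X in measurable X]setTI; exact: measurable_cons_rV.
rewrite /lebesgue_cons /pushforward preimage_bigcup.
apply: measure_semi_sigma_additive.
- by move=> i; exact: mcons.
- apply/trivIsetP => /= i j _ _ ij; rewrite -preimage_setI.
  by move/trivIsetP : tF => /(_ _ _ _ _ ij) ->//; rewrite preimage_set0.
- by rewrite -preimage_bigcup; exact: mcons.
Qed.

HB.instance Definition _ := isMeasure.Build _ _ _ lebesgue_cons
  lebesgue_cons0 lebesgue_cons_ge0 lebesgue_cons_sigma_additive.

Let tail_rV (v : borel R n.+1) : measurableTypeR R * borel R n :=
  ((v : 'rV[R]_n.+1) 0 ord0, (\row_j (v : 'rV[R]_n.+1) 0 (lift ord0 j) : 'rV[R]_n)).

Let cons_rVK : cancel (@cons_rV n) tail_rV.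
Proof.
move=> [x w]; congr (_, _).
  have -> : ord0 = lshift n 0 :> 'I_(1 + n) by exact/val_inj.
  by rewrite [LHS]row_mxEl mxE.
apply/rowP => j; rewrite mxE.
have -> : lift ord0 j = rshift 1 j :> 'I_(1 + n) by exact/val_inj.
by rewrite [LHS]row_mxEr.
Qed.

Let measurable_tail_rV : measurable_fun setT tail_rV.
Proof.
apply: measurable_fun_pair; first exact: measurable_borel_coord.
apply: measurable_fun_borel => j.
rewrite (_ : (fun v => _) = fun v : borel R n.+1 => (v : 'rV[R]_n.+1) 0 (lift ord0 j)).
  exact: measurable_borel_coord.
by apply/funext => v; rewrite mxE.
Qed.

Let lebesgue_cons_sigma_finite : sigma_finite setT lebesgue_cons.
Proof.
have /sigma_finiteP[F [FT ndF Foo]] := sigma_finiteT (@lebesgue_measure R).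
have /sigma_finiteP[G [GT ndG Goo]] := sigma_finiteT m.
exists (fun i => tail_rV @^-1` (F i `*` G i)).
  rewrite -preimage_bigcup (_ : \bigcup_i _ = setT) ?preimage_setT//.
  apply/seteqP; split=> // -[x y] _.
  have [[i _ Fx] [j _ Gy]] : (\bigcup_i F i) x /\ (\bigcup_i G i) y.
    by rewrite -FT -GT.
  exists (maxn i j) => //; split.
    by move: x Fx; exact/subsetPset/ndF/leq_maxl.
  by move: y Gy; exact/subsetPset/ndG/leq_maxr.
move=> i; have [mFi Fi] := Foo i; have [mGi Gi] := Goo i.
have mFG : measurable (F i `*` G i) by exact: measurableX.
split; first by rewrite -[X in measurable X]setTI; exact: measurable_tail_rV.
rewrite /lebesgue_cons /pushforward -comp_preimage.
rewrite (_ : tail_rV \o _ = id) ?preimage_id; last first.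
  by apply/funext => p; exact: cons_rVK.
by rewrite product_measure1E// lte_mul_pinfty// ge0_fin_numE.
Qed.

HB.instance Definition _ := Measure_isSigmaFinite.Build _ _ _ lebesgue_cons
  lebesgue_cons_sigma_finite.

End step.

(* Lebesgue measure on R^n, as an iterated product; see lebesgue_rV_box. *)
Fixpoint lebesgue_rV n : {sigma_finite_measure set (borel R n) -> \bar R} :=
  if n is n'.+1 return {sigma_finite_measure set (borel R n) -> \bar R}
  then lebesgue_cons (lebesgue_rV n')
  else dirac ((0 : 'rV[R]_0) : borel R 0).

Lemma lebesgue_rV_box n (A : 'I_n -> set (measurableTypeR R)) :
  (forall i, measurable (A i)) ->
  lebesgue_rV n [set v | forall i, A i ((v : 'rV[R]_n) 0 i)] =
  (\prod_(i < n) lebesgue_measure (A i))%E.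
Proof.
elim: n A => [|n IH] A mA.
  rewrite big_ord0 /= /dirac indicE mem_set// => -[]//.
rewrite big_ord_recl -IH//= /lebesgue_cons /pushforward.
rewrite -product_measure1E//; last first.
  rewrite (_ : mkset _ = \bigcap_(i : 'I_n)
      ((fun v : borel R n => (v : 'rV[R]_n) 0 i) @^-1` A (lift ord0 i))).
    apply: fin_bigcap_measurable => //= i _.
    by rewrite -[X in measurable X]setTI; apply: measurable_borel_coord; last exact: mA.
  by apply/seteqP; split=> v /= h i => [_|]; exact: h.
congr (product_measure1 _ _ _); apply/seteqP; split=> -[x w] /=.
  move=> h; split.
    have := h ord0; have -> : ord0 = lshift n 0 :> 'I_(1 + n) by exact/val_inj.
    by rewrite [X in A _ X -> _]row_mxEl mxE.
  move=> j; have := h (lift ord0 j).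
  have -> : lift ord0 j = rshift 1 j :> 'I_(1 + n) by exact/val_inj.
  by rewrite [X in A _ X -> _]row_mxEr.
move=> [h0 h1] i; have [j ij|j ij] := split_ordP (i : 'I_(1 + n)).
  rewrite [X in A _ X](_ : _ = x); last by rewrite ij [LHS]row_mxEl mxE.
  by rewrite ij (_ : lshift n j = ord0)//; apply/val_inj; rewrite /= ord1.
rewrite [X in A _ X](_ : _ = w 0 j); last by rewrite ij [LHS]row_mxEr.
by rewrite ij (_ : rshift 1 j = lift ord0 j)//; exact/val_inj.
Qed.

End lebesgue_rV.

Section dynamics.
Context {R : realType} {d : nat}.
Local Notation V := 'rV[R]_d.
Variables (A : {linear V -> V}) (B : {bilinear V -> V -> V}) (f : V).

Definition vfield (v : V) : V := - A v - B v v + f.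

(* x solves du/dt = vfield u on the closed interval between 0 and t, for t of
   either sign; at the endpoints only continuity is asked, which yields the
   one-sided derivatives there. *)
Definition is_solution (v : V) (t : R) (x : R -> V) : Prop :=
  [/\ x 0 = v,
      {within `[Num.min 0 t, Num.max 0 t], continuous x} &
      forall s, s \in `]Num.min 0 t, Num.max 0 t[ ->
        is_derive s 1 x (vfield (x s))].

(* Psi t v is the value at time t of the solution starting at v.  The first
   clause constrains Psi t v for every t (of either sign) and v such that the
   solution lives up to time t, in particular in a neighbourhood of the ball, so
   that the Jacobians of Psi are meaningful at its boundary.  For t >= 0,
   Psi (- t) is then the inverse of Psi t, see flow_inverse.  The second clause
   is the global existence of the solutions starting in the ball.  Elsewhere,
   Psi is arbitrary. *)
Definition is_flow (r : R) (Psi : R -> V -> V) : Prop :=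
  (forall v t x, is_solution v t x -> Psi t v = x t) /\
  (forall v t, ball2 r v -> 0 <= t -> is_solution v t (Psi ^~ v)).

Definition trapping_ball (r delta : R) : Prop :=
  forall v : V, r <= norm2 v <= r + delta -> dot2 (vfield v) v <= 0.

Lemma flow_inverse r Psi v t : is_flow r Psi -> ball2 r v -> 0 <= t ->
  Psi (- t) (Psi t v) = v.
Proof.
move=> [Psisol Psiball] rv t0.
have [Psi0 Psic Psid] := Psiball v t rv t0.
rewrite (Psisol _ _ (fun s => Psi (s + t) v)); first by rewrite addNr.
rewrite /is_solution min_r ?oppr_le0// max_l ?oppr_le0//.
move: Psic Psid; rewrite min_l// max_r// => Psic Psid.
split; first by rewrite add0r.
  apply/subspace_continuousP => s /=; rewrite in_itv/= => /andP[ts s0].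
  have st : `[0, t]%classic (s + t).
    by rewrite /= in_itv/= -lerBlDr sub0r ts/= gerDr.
  move/subspace_continuousP : Psic => /(_ _ st) Psic U /Psic.
  rewrite /fmap/= /within/= => nU.
  have : \forall z \near s, `[0, t]%classic (z + t) -> U (Psi (z + t) v).
    have ct : {for s, continuous (fun z : R => z + t)}.
      by apply: cvgD; [exact: cvg_id|exact: cvg_cst].
    exact: ct nU.
  apply: filterS => z h zt; apply: h; move: zt.
  by rewrite /= !in_itv/= -lerBlDr sub0r gerDr.
move=> s; rewrite in_itv/= => /andP[ts s0].
have /Psid [dPsi DPsi] : s + t \in `]0, t[.
  by rewrite in_itv/= -ltrBlDr sub0r ts/= gtrDr.
have E : (fun h : R => h^-1 *: (((fun s0 => Psi (s0 + t) v) \o shift s) (h *: 1)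
    - Psi (s + t) v)) =
  (fun h => h^-1 *: ((Psi ^~ v \o shift (s + t)) (h *: 1) - Psi (s + t) v)).
  by apply/funext => h; rewrite /= addrA.
by split; rewrite /derivable /derive E.
Qed.

End dynamics.

Section filtering.
Context {R : realType} {d o : nat}.

(* Density of the standard Gaussian distribution on R^n. *)
Definition gauss_pdf n (z : 'rV[R]_n) : R :=
  (Num.sqrt (2 * pi)) ^- n * expR (- (norm2 z ^+ 2 / 2)).

(* Density of eps *: N when N is standard Gaussian. *)
Definition noise_pdf n (eps : R) (z : 'rV[R]_n) : R :=
  eps ^- n * gauss_pdf (eps^-1 *: z).

Definition is_pdf n (p : 'rV[R]_n -> R) : Prop :=
  [/\ measurable_fun setT (p : borel R n -> R),
      forall v, 0 <= p v &
      (\int[lebesgue_rV n]_v (p v)%:E = 1)%E].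

(* The filtering density given y_0, ..., y_k (with t_i = i h), up to its
   normalising constant. *)
Definition filtering_weight (Psi : R -> 'rV[R]_d -> 'rV[R]_d) (r h eps : R)
    (H : 'M[R]_(o, d)) (q : 'rV[R]_d -> R) (k : nat)
    (y : nat -> 'rV[R]_o) (v : 'rV[R]_d) : R :=
  if v \in Psi (k%:R * h) @` ball2 r then
    let v0 := Psi (- (k%:R * h)) v in
    (\prod_(i < k.+1) noise_pdf eps (y i - mxapp H (Psi (i%:R * h) v0))) *
    \det ('J (Psi (- (k%:R * h))) v) * q v0
  else 0.

(* mu k y is the filtering density given y_0, ..., y_k. *)
Definition is_filtering_density (Psi : R -> 'rV[R]_d -> 'rV[R]_d) (r h eps : R)
    (H : 'M[R]_(o, d)) (q : 'rV[R]_d -> R)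
    (mu : nat -> (nat -> 'rV[R]_o) -> 'rV[R]_d -> R) : Prop :=
  forall k y, is_pdf (mu k y) /\
    exists2 c : R, 0 < c &
      forall v, mu k y v = c * filtering_weight Psi r h eps H q k y v.

(* 'J is the transpose of the usual Jacobian matrix (row vector convention). *)
Definition equi_jacobian_set (Psi : R -> 'rV[R]_d -> 'rV[R]_d) (t : R)
    (u : 'rV[R]_d) : set 'rV[R]_d :=
  [set v | \det ('J (Psi t) v) = \det ('J (Psi t) u)].

End filtering.

Section noise.
Context {R : realType} {o : nat} {disp : measure_display}
  {T : measurableType disp} (P : probability T R).

Definition std_gaussian (X : T -> 'rV[R]_o) : Prop :=
  forall S : set (borel R o), measurable S ->
    P (X @^-1` S) = (\int[lebesgue_rV o]_(z in S) (gauss_pdf z)%:E)%E.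

Definition mutually_independent (Z : nat -> {RV P >-> borel R o}) : Prop :=
  forall (I : seq nat) (S : nat -> set (borel R o)), uniq I ->
    (forall i, measurable (S i)) ->
    P (\bigcap_(i in [set` I]) (Z i @^-1` S i)) =
    (\prod_(i <- I) P (Z i @^-1` S i))%E.

(* The Z_i are independent and each Z_i / eps is standard Gaussian; in
   particular they are identically distributed. *)
Definition gaussian_noise (eps : R) (Z : nat -> {RV P >-> borel R o}) : Prop :=
  mutually_independent Z /\
  forall i, std_gaussian (fun w => eps^-1 *: (Z i w : 'rV[R]_o)).

End noise.

(* Main.v *)
Require Import Defs.
From HB Require Import structures.
From mathcomp Require Import all_boot all_order all_algebra sesquilinear.
From mathcomp Require Import all_classical all_reals all_analysis.
From mathcomp Require Import measurable_realfun.
From mathcomp Require Import ring lra.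

Set Implicit Arguments.
Unset Strict Implicit.
Unset Printing Implicit Defensive.

Import Order.TTheory GRing.Theory Num.Theory.
Import numFieldNormedType.Exports.

Local Open Scope classical_set_scope.
Local Open Scope ring_scope.

(** Fix k = idx j and put s = eps / (|H| sqrt C2u).  Since the distances at time
    t_k between u(t_k) and the points of the anti-leaf set fill an interval
    that contains s for small eps, some v in U k satisfies
    |v(t_k) - u(t_k)| = s, so the diameter is at least s as soon as both v(t_k)
    and u(t_k) belong to the level set.  Write D_i = Psi_{t_i} v - Psi_{t_i} u.
    The hypothesis on U k gives sum |H D_i|^2 <= |H|^2 C2u s^2 = eps^2, and the
    Gaussian likelihood ratio is
      exp ((2 sum <Z_i, H D_i> - sum |H D_i|^2) / (2 eps^2)),
    which is at least exp (- 1/2) on the event E that sum <Z_i, H D_i> >= 0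
    ([likelihood_ratio]).  The joint law of the noise is invariant under
    Z |-> - Z, so P(E) >= 1/2 ([noise_sum_ge0]).  The term i = 0 shows that
    |v - u| <= eps / |H|, hence continuity of q at u bounds the ratio of the
    priors below by exp (- 1/2), uniformly in j ([near_center_prior]).  The two
    Jacobian factors coincide.  So on E the ratio of filtering densities is at
    least 1/e, and the expectation is at least s / 2.

    The Jacobian factors are the delicate point: the anti-leaf condition is on
    det J Psi_{t_k} at the initial points, whereas the density contains
    det J Psi_{- t_k} at the final points.  They are mutually inverse provided
    that both flow maps are differentiable, with Psi_{- t} o Psi_t = id near
    the initial point ([flow_jacobian_inverse]).  Positivity of q at u and
    its continuity there place u and v in the interior of the ball, where
    forward solutions exist for all times.

    Differentiability is obtained from Taylor series in time.  The coefficients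
    of the solution of du/dt = - A u - B(u, u) + f satisfy
      (n + 1) a_{n+1} = - A a_n - sum_{i <= n} B (a_i, a_{n-i}) + f [n = 0];
    the factor n + 1 on the left absorbs the number of terms of the
    convolution, so that |a_n| <= M K^n by induction, uniformly for initial
    points in a bounded set ([taylor_coeffs_bound]).  The same recursion,
    linearised, bounds the first variation and shows that the remainder is
    quadratic in the displacement of the initial point
    ([taylor_series_expansion]).  Hence for short times the flow is given by
    power series, for both signs of time, and is differentiable
    ([uniform_local_solution]).  For long times Psi_t is an iterate of
    Psi_{t/N} along the orbit, which is bounded, and Psi_{- t} the
    corresponding iterate of Psi_{- t/N} ([flow_differentiable]). *)

(** * Bounds for linear and bilinear maps of row vectors *)

Section coordinates.
Context {R : realType}.

Lemma coord_le_norm m n (M : 'M[R]_(m, n)) i j : `|M i j| <= `|M|.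
Proof. by rewrite [leRHS]/Num.norm/= mx_normrE (le_bigmax _ _ (i, j)). Qed.

Lemma norm_le_coord m n (M : 'M[R]_(m, n)) (c : R) :
  0 <= c -> (forall i j, `|M i j| <= c) -> `|M| <= c.
Proof.
by move=> c0 Mc; rewrite [leLHS]/Num.norm/= mx_normrE bigmax_le// => -[i j] _; exact: Mc.
Qed.

Lemma norm_delta_mx d (i : 'I_d) : `|delta_mx 0 i : 'rV[R]_d| <= 1.
Proof.
apply: norm_le_coord => // k j; rewrite mxE ord1 eqxx/=.
by case: (_ == _); rewrite ?normr0// normr1.
Qed.

End coordinates.

Section bounded_maps.
Context {R : realType} {d : nat}.
Local Notation V := 'rV[R]_d.

Lemma linear_rV_bound (A : {linear V -> V}) :
  exists2 c : R, 0 <= c & forall x, `|A x| <= c * `|x|.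
Proof.
exists (\sum_(i < d) `|A (delta_mx 0 i)|); first exact: sumr_ge0.
move=> x; rewrite {1}[x]row_sum_delta linear_sum mulr_suml.
apply: le_trans (ler_norm_sum _ _ _) _; apply: ler_sum => i _.
by rewrite linearZ/= normrZ mulrC ler_wpM2l// coord_le_norm.
Qed.

Lemma bilinear_rV_bound (B : {bilinear V -> V -> V}) :
  exists2 c : R, 0 <= c & forall x y, `|B x y| <= c * `|x| * `|y|.
Proof.
have /choice[c cP] (i : 'I_d) :
    exists c : R, 0 <= c /\ forall y, `|B (delta_mx 0 i) y| <= c * `|y|.
  by have [c c0 cB] := linear_rV_bound (B (delta_mx 0 i)); exists c.
exists (\sum_(i < d) c i); first by apply: sumr_ge0 => i _; case: (cP i).
move=> x y; rewrite {1}[x]row_sum_delta linear_sumlz !mulr_suml.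
apply: le_trans (ler_norm_sum _ _ _) _; apply: ler_sum => i _.
rewrite linearZl_LR normrZ mulrAC mulrC ler_pM//; last exact: coord_le_norm.
by case: (cP i).
Qed.

End bounded_maps.

(** * Vector-valued power series with geometrically bounded coefficients *)

Section power_series.
Context {R : realType} {d : nat}.
Local Notation V := 'rV[R]_d.
Implicit Types (a b : nat -> V) (t : R).

Definition geo_bounded (M K : R) a := forall n, `|a n| <= M * K ^+ n.

Definition psum a t (N : nat) : V := \sum_(n < N) t ^+ n *: a n.

Definition vseries a t : V := \row_k limn (pseries (fun n => a n 0 k) t).

Lemma cvg_rV (u : nat -> V) (l : V) :
  (forall k, (u n 0 k) @[n --> \oo] --> l 0 k) -> u @ \oo --> l.
Proof.
move=> ul; apply/cvgrPdist_le => /= e e0; near=> n.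
apply: norm_le_coord (ltW e0) _ => i j; rewrite ord1 !mxE.
move: j; near: n; apply: filter_forall => j.
exact: (cvgrPdist_le _ _).1.
Unshelve. all: by end_near. Qed.

Lemma geo_coord_cvg M K a t k : geo_bounded M K a -> 0 <= K -> `|t| * K < 1 ->
  cvgn (pseries (fun n => a n 0 k) t).
Proof.
move=> aMK K0 tK; apply: normed_cvg; rewrite /normed_series_of.
apply: (@series_le_cvg _ _ (geometric `|M| (`|t| * K))) => //= [n|n|].
- by rewrite mulr_ge0// exprn_ge0// mulr_ge0.
- rewrite normrM normrX exprMn mulrCA mulrC ler_pM//.
  apply: le_trans (coord_le_norm _ _ _) _; apply: le_trans (aMK n) _.
  by rewrite ler_wpM2r ?exprn_ge0// ler_norm.
- by apply: is_cvg_geometric_series; rewrite ger0_norm// mulr_ge0.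
Qed.

Lemma psum_cvg M K a t : geo_bounded M K a -> 0 <= K -> `|t| * K < 1 ->
  psum a t @ \oo --> vseries a t.
Proof.
move=> aMK K0 tK; apply: cvg_rV => k; rewrite mxE.
rewrite (_ : (fun n => _) = pseries (fun n => a n 0 k) t).
  exact: geo_coord_cvg aMK K0 tK.
apply/funext => N; rewrite /psum summxE /pseries/= /series/= big_mkord.
by apply: eq_bigr => i _; rewrite mxE mulrC.
Qed.

Lemma vseries_unique M K a t (l : V) : geo_bounded M K a -> 0 <= K -> `|t| * K < 1 ->
  psum a t @ \oo --> l -> vseries a t = l.
Proof.
move=> aMK K0 tK; exact: norm_cvg_unique (psum_cvg aMK K0 tK).
Qed.

Lemma vseries_bound M K a t : geo_bounded M K a -> 0 <= K ->
  `|t| * K <= 1 / 2 -> `|vseries a t| <= 2 * M.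
Proof.
move=> aMK K0 tK; have tK1 : `|t| * K < 1 by lra.
have tK0 : 0 <= `|t| * K by rewrite mulr_ge0.
have M0 : 0 <= M by have := aMK 0%N; rewrite expr0 mulr1; exact: le_trans.
have /cvg_norm cva := psum_cvg aMK K0 tK1.
rewrite -(cvg_lim _ cva)//; apply: limr_le; first by apply/cvg_ex; exists `|vseries a t|.
near=> N; apply: le_trans (ler_norm_sum _ _ _) _.
apply: (@le_trans _ _ (\sum_(n < N) M * (1 / 2) ^+ n)).
  apply: ler_sum => n _; rewrite normrZ normrX mulrC.
  apply: (@le_trans _ _ (M * K ^+ n * `|t| ^+ n)).
    by rewrite ler_wpM2r// exprn_ge0.
  by rewrite -mulrA ler_wpM2l// -exprMn mulrC lerXn2r// nnegrE.
rewrite -mulr_sumr mulrC ler_wpM2r//.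
have : \sum_(i < N) (1 / 2) ^+ i = 2 - 2 * (1 / 2) ^+ N :> R.
  elim: (N) => [|m IH]; first by rewrite big_ord0 expr0; lra.
  by rewrite big_ord_recr/= IH exprS; lra.
by move=> ->; rewrite gerBl mulr_ge0// exprn_ge0.
Unshelve. all: by end_near. Qed.

Lemma vseries0 a : vseries a 0 = a 0%N.
Proof.
apply/rowP => k; rewrite mxE; apply/cvg_lim => //.
rewrite -(cvg_shiftn 1); apply: cvg_near_cst; near=> n.
rewrite /pseries /series/= addn1 big_nat_recl// expr0 mulr1 big1 ?addr0// => i _.
by rewrite expr0n mulr0.
Unshelve. all: by end_near. Qed.

Definition vdiffs a n : V := n.+1%:R *: a n.+1.

Lemma geo_bounded_diffs M K a : geo_bounded M K a -> 0 <= K ->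
  geo_bounded (M * K) (2 * K) (vdiffs a).
Proof.
move=> aMK K0 n; rewrite normrZ normr_nat.
have M0 : 0 <= M by have := aMK 0%N; rewrite expr0 mulr1; exact: le_trans.
apply: (@le_trans _ _ (2 ^+ n * (M * K ^+ n.+1))).
  by rewrite ler_pM// -natrX ler_nat ltn_expl.
by rewrite exprMn exprS le_eqVlt; apply/orP; left; apply/eqP; ring.
Qed.

(** The factor 8 leaves room to differentiate twice: since n + 1 <= 2^n, each
    formal derivative at most doubles the geometric rate of the coefficients. *)
Lemma vseries_derive M K a t : geo_bounded M K a -> 0 < K ->
  `|t| * (8 * K) < 1 -> is_derive t 1 (vseries a) (vseries (vdiffs a) t).
Proof.
move=> aMK K0 tK.
have daMK := geo_bounded_diffs aMK (ltW K0).
have ddaMK := geo_bounded_diffs daMK (mulr_ge0 (ler0n _ _) (ltW K0)).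
have dk k : is_derive t 1 (fun s => vseries a s 0 k) (vseries (vdiffs a) t 0 k).
  pose X := (8 * K)^-1; have X0 : 0 < X by rewrite invr_gt0 mulr_gt0.
  have XK : X * K = 1 / 8 by rewrite /X invfM mulrAC mulfK ?gt_eqF//; lra.
  have nX : `|X| = X by rewrite gtr0_norm.
  have := @pseries_snd_diffs _ (fun n => a n 0 k) X t.
  have E b : (fun n => (vdiffs b) n 0 k) = pseries_diffs (fun n => b n 0 k).
    by apply/funext => n; rewrite mxE.
  rewrite -!E (_ : (fun s => vseries a s 0 k) =
    (fun s => limn (pseries (fun n => a n 0 k) s))); last first.
    by apply/funext => s; rewrite mxE.
  rewrite [vseries _ _ _ _]mxE; apply.
  - have tX : `|X| * K < 1 by rewrite nX; lra.
    exact: geo_coord_cvg aMK (ltW K0) tX.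
  - have tX : `|X| * (2 * K) < 1 by rewrite nX; lra.
    by apply: geo_coord_cvg daMK _ tX; rewrite mulr_ge0// ltW.
  - have tX : `|X| * (2 * (2 * K)) < 1 by rewrite nX; lra.
    by apply: geo_coord_cvg ddaMK _ tX; rewrite !mulr_ge0// ltW.
  - by rewrite nX /X -[_^-1]mul1r ltr_pdivlMr// mulr_gt0.
have da : derivable (vseries a) t 1.
  by apply/derivable_mxP => i k; rewrite ord1; case: (dk k).
split=> //; rewrite derive_mx//; apply/rowP => k; rewrite mxE.
by case: (dk k).
Qed.

End power_series.

(** * Taylor series of the solutions of a quadratic differential equation *)

Lemma sum_triangle (W : zmodType) (g : nat -> nat -> W) N :
  \sum_(n < N) \sum_(i < n.+1) g i (n - i)%N =
  \sum_(i < N) \sum_(j < N | (i + j < N)%N) g i j.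
Proof.
transitivity (\sum_(0 <= n < N) \sum_(0 <= i < N | (i <= n)%N) g i (n - i)%N).
  rewrite big_mkord; apply: eq_bigr => n _.
  rewrite -(big_mkord xpredT (fun i => g i (n - i)%N)) (big_nat_widen 0 n.+1 N)//.
rewrite (exchange_big_dep_nat xpredT)//= big_mkord; apply: eq_bigr => i _.
rewrite -(big_mkord (fun j => (i + j < N)%N) (fun j => g i j)).
transitivity (\sum_(0 <= j < N - i) g i j).
  rewrite -(big_nat_widenl i 0 N xpredT (fun n => g i (n - i)%N))// -{1}[val i]add0n big_addn.
  by apply: eq_bigr => j _; rewrite addnK.
rewrite (big_nat_widen 0 (N - i) N) ?leq_subr//; apply: eq_bigl => j /=.
by rewrite ltn_subRL.
Qed.

(** Course-of-values recursion.  The function [pref n] holds the values at all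
    indices up to n, so that [step] only sees values already computed. *)
Lemma rec_exists (T : Type) (x0 : T) (step : nat -> (nat -> T) -> T) :
  (forall n g g', (forall i, (i <= n)%N -> g i = g' i) -> step n g = step n g') ->
  exists a, a 0%N = x0 /\ forall n, a n.+1 = step n a.
Proof.
move=> stepE.
pose pref := fix pref n : nat -> T :=
  if n is m.+1 then fun i => if (i <= m)%N then pref m i else step m (pref m)
  else fun=> x0.
have prefE n i : (i <= n)%N -> pref n i = pref i i.
  elim: n => [|n IH]; first by rewrite leqn0 => /eqP ->.
  by rewrite leq_eqVlt => /predU1P[->//|]; rewrite ltnS /= => ilen; rewrite ilen IH.
exists (fun n => pref n n); split=> // n.
by rewrite /= ltnn; apply: stepE => i /prefE.
Qed.

Section quadratic_series.
Context {R : realType} {d : nat}.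
Local Notation V := 'rV[R]_d.
Variables (A : {linear V -> V}) (B : {bilinear V -> V -> V}) (f : V).
Implicit Types (a b p q z : nat -> V) (t : R).

Definition conv a b n : V := \sum_(i < n.+1) B (a i) (b (n - i)%N).

Lemma linear_rV_continuous : continuous A.
Proof.
apply/linear_bounded_continuous; have [c c0 Ac] := linear_rV_bound A.
exists c; split=> [|M cM]; first exact: ger0_real.
near=> x; apply: le_trans (Ac x) _; apply: (@le_trans _ _ (c * 1)).
  rewrite ler_wpM2l//; near: x; exact: nbhs0_le.
by rewrite mulr1 ltW.
Unshelve. all: by end_near. Qed.

Lemma psum_linear a t N : psum (A \o a) t N = A (psum a t N).
Proof. by rewrite /psum linear_sum; apply: eq_bigr => i _; rewrite linearZ. Qed.

Lemma psum_conv a b t N :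
  B (psum a t N) (psum b t N) - psum (conv a b) t N =
  \sum_(i < N) \sum_(j < N | (N <= i + j)%N) t ^+ (i + j) *: B (a i) (b j).
Proof.
pose g i j := t ^+ (i + j) *: B (a i) (b j).
have -> : B (psum a t N) (psum b t N) = \sum_(i < N) \sum_(j < N) g i j.
  rewrite /psum linear_sumlz; apply: eq_bigr => i _.
  rewrite linear_sumr; apply: eq_bigr => j _.
  by rewrite linearZl_LR linearZr_LR scalerA -exprD.
have -> : psum (conv a b) t N = \sum_(n < N) \sum_(i < n.+1) g i (n - i)%N.
  apply: eq_bigr => n _; rewrite scaler_sumr; apply: eq_bigr => i _.
  by rewrite /g subnKC// -ltnS.
rewrite sum_triangle -sumrB; apply: eq_bigr => i _.
rewrite (bigID (fun j : 'I_N => (i + j < N)%N))/= addrAC subrr add0r.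
by apply: eq_bigl => j; rewrite -leqNgt.
Qed.

(** Cauchy product.  The partial sums of the product series and the product of
    the partial sums differ by the terms with i + j >= N: at most N^2 <= 4^N
    terms, each of size 8^-N, which explains the bound 1 / 8. *)
Lemma psum_conv_cvg Ma Mb K a b t : geo_bounded Ma K a -> geo_bounded Mb K b ->
  0 <= K -> `|t| * K <= 1 / 8 ->
  psum (conv a b) t @ \oo --> B (vseries a t) (vseries b t).
Proof.
move=> aK bK K0 tK; have tK1 : `|t| * K < 1 by lra.
have tK0 : 0 <= `|t| * K by rewrite mulr_ge0.
have [c c0 Bc] := bilinear_rV_bound B.
have Ma0 : 0 <= Ma by have := aK 0%N; rewrite expr0 mulr1; exact: le_trans.
have Mb0 : 0 <= Mb by have := bK 0%N; rewrite expr0 mulr1; exact: le_trans.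
set x := vseries a t; set y := vseries b t.
have xN : psum a t @ \oo --> x by exact: psum_cvg aK K0 tK1.
have yN : psum b t @ \oo --> y by exact: psum_cvg bK K0 tK1.
pose r N := c * (`|x - psum a t N| * `|y| + `|psum a t N| * `|y - psum b t N|) +
  c * Ma * Mb * (1 / 2) ^+ N.
have r0 : r @ \oo --> c * (`|x - x| * `|y| + `|x| * `|y - y|) + c * Ma * Mb * 0.
  apply: cvgD; last by apply: cvgMr; apply: cvg_expr; rewrite ger0_norm; lra.
  apply: cvgMr; apply: cvgD.
    by apply: cvgMl; apply: cvg_norm; apply: cvgB => //; exact: cvg_cst.
  apply: cvgM; first exact: cvg_norm.
  by apply: cvg_norm; apply: cvgB => //; exact: cvg_cst.
rewrite !subrr normr0 mul0r mulr0 addr0 mulr0 mulr0 addr0 in r0.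
have tailN N : `|B (psum a t N) (psum b t N) - psum (conv a b) t N| <=
    c * Ma * Mb * (1 / 2) ^+ N.
  rewrite psum_conv; apply: (@le_trans _ _ (\sum_(i < N) \sum_(j < N)
      c * Ma * Mb * (1 / 8) ^+ N)).
    apply: le_trans (ler_norm_sum _ _ _) _; apply: ler_sum => i _.
    apply: le_trans (ler_norm_sum _ _ _) _.
    rewrite big_mkcond; apply: ler_sum => j _; case: ifPn => Nij; last first.
      by rewrite !mulr_ge0// exprn_ge0.
    rewrite normrZ normrX; apply: (@le_trans _ _
      (`|t| ^+ (i + j) * (c * (Ma * K ^+ i) * (Mb * K ^+ j)))).
      rewrite ler_wpM2l ?exprn_ge0//; apply: le_trans (Bc _ _) _.
      by rewrite ler_pM ?mulr_ge0// ler_wpM2l.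
    rewrite (_ : `|t| ^+ (i + j) * _ = c * Ma * Mb * (`|t| * K) ^+ (i + j)); last first.
      by rewrite exprMn !exprD; ring.
    rewrite ler_wpM2l ?mulr_ge0//.
    apply: (@le_trans _ _ ((1 / 8) ^+ (i + j))); first by rewrite lerXn2r// nnegrE.
    by apply: ler_wiXn2l => //; lra.
  rewrite !sumr_const card_ord -mulrnA -[leLHS]mulr_natr -(mulrA (c * Ma * Mb)).
  rewrite ler_wpM2l ?mulr_ge0//.
  apply: (@le_trans _ _ ((1 / 8) ^+ N * (4 ^+ N))).
    rewrite ler_wpM2l ?exprn_ge0// natrM -[4](_ : 2 * 2 = _); last by lra.
    by rewrite exprMn ler_pM// -natrX ler_nat ltnW// ltn_expl.
  by rewrite -exprMn (_ : 1 / 8 * 4 = 1 / 2 :> R)//; lra.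
apply/cvgrPdist_le => e e0.
move/cvgrPdist_le : r0 => /(_ _ e0) r0; near=> N.
apply: (@le_trans _ _ (r N)); last first.
  apply: le_trans (ler_norm _) _; rewrite -normrN -[- r N]add0r.
  by near: N.
rewrite -(subrK (B (psum a t N) (psum b t N)) (B x y)) -addrA.
apply: le_trans (ler_normD _ _) _; apply: lerD => //.
rewrite (_ : B x y - _ = B (x - psum a t N) y + B (psum a t N) (y - psum b t N)).
  by apply: le_trans (ler_normD _ _) _; rewrite mulrDr !mulrA lerD.
by rewrite linearBl linearBr; rewrite addrA subrK.
Unshelve. all: by end_near. Qed.

(** [vdiffs a] is the coefficient sequence of the derivative, and [conv a a]
    that of B (x, x): these are the Taylor coefficients of the solution that
    starts at v. *)
Definition taylor_coeffs (v : V) a :=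
  a 0%N = v /\
  forall n, vdiffs a n = - A (a n) - conv a a n + (if n == 0%N then f else 0).

(** Linearised recursion.  With p = q = a it is the first variation along the
    solution with coefficients a; p <> q accounts for exact differences of two
    solutions, as B (x', x') - B (x, x) = B (x', x' - x) + B (x' - x, x). *)
Definition variation_coeffs p q (g : nat -> V) (z0 : V) z :=
  z 0%N = z0 /\
  forall n, vdiffs z n = - A (z n) - conv p z n - conv z q n + g n.

Lemma eq_conv a a' b b' n : (forall i, (i <= n)%N -> a i = a' i) ->
  (forall i, (i <= n)%N -> b i = b' i) -> conv a b n = conv a' b' n.
Proof.
move=> aa bb; apply: eq_bigr => i _.
by rewrite aa -1?ltnS// bb// leq_subr.
Qed.

Lemma vdiffs_inv (w : V) n : n.+1%:R *: (n.+1%:R^-1 *: w) = w.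
Proof. by rewrite scalerA mulfV ?scale1r// pnatr_eq0. Qed.

Lemma taylor_coeffs_exist v : exists a, taylor_coeffs v a.
Proof.
have [] := @rec_exists V v (fun n a => n.+1%:R^-1 *:
    (- A (a n) - conv a a n + (if n == 0%N then f else 0))).
  by move=> n a b ab; rewrite ab// (eq_conv ab ab).
by move=> a [a0 aS]; exists a; split=> // n; rewrite /vdiffs aS vdiffs_inv.
Qed.

Lemma variation_coeffs_exist p q (g : nat -> V) (z0 : V) : exists z, variation_coeffs p q g z0 z.
Proof.
have [] := @rec_exists V z0 (fun n z => n.+1%:R^-1 *:
    (- A (z n) - conv p z n - conv z q n + g n)).
  by move=> n a b ab; rewrite ab// (@eq_conv p p a b)// (@eq_conv a b q q).
by move=> z [z_0 zS]; exists z; split=> // n; rewrite /vdiffs zS vdiffs_inv.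
Qed.

Lemma geo_bounded_rec c K z : `|z 0%N| <= c ->
  (forall n, (forall i, (i <= n)%N -> `|z i| <= c * K ^+ i) ->
     `|vdiffs z n| <= n.+1%:R * (c * K ^+ n.+1)) ->
  geo_bounded c K z.
Proof.
move=> z0 zS n; have [m] := ubnP n; elim: m n => // m IH [|n] nm.
  by rewrite expr0 mulr1.
have /zS : forall i, (i <= n)%N -> `|z i| <= c * K ^+ i.
  by move=> i ilen; apply: IH; exact: leq_ltn_trans ilen _.
by rewrite normrZ normr_nat ler_pM2l// ltr0n.
Qed.

Variables (alpha beta : R).
Hypotheses (alpha0 : 0 <= alpha) (beta0 : 0 <= beta).
Hypothesis A_bound : forall x, `|A x| <= alpha * `|x|.
Hypothesis B_bound : forall x y, `|B x y| <= beta * `|x| * `|y|.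

Lemma conv_bound (M c K : R) p z n : 0 <= M -> 0 <= c -> 0 <= K ->
  (forall i, (i <= n)%N -> `|p i| <= M * K ^+ i) ->
  (forall i, (i <= n)%N -> `|z i| <= c * K ^+ i) ->
  `|conv p z n| <= n.+1%:R * (beta * M * c * K ^+ n).
Proof.
move=> M0 c0 K0 pM zc; apply: le_trans (ler_norm_sum _ _ _) _.
apply: (@le_trans _ _ (\sum_(i < n.+1) beta * M * c * K ^+ n)).
  apply: ler_sum => i _; apply: le_trans (B_bound _ _) _.
  have ilen : (i <= n)%N by rewrite -ltnS.
  rewrite -[in leRHS](subnKC ilen) exprD.
  rewrite (_ : _ * _ * _ * (_ * _) = beta * (M * K ^+ i) * (c * K ^+ (n - i))); last ring.
  rewrite ler_pM ?mulr_ge0//; last by apply: zc; rewrite leq_subr.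
  by rewrite ler_wpM2l// pM.
by rewrite sumr_const card_ord mulr_natl.
Qed.

(** The convolution has n + 1 terms, each at most beta M^2 K^n; dividing by the
    factor n + 1 of the recursion leaves a bound independent of n. *)
Lemma taylor_coeffs_bound M K v a : 1 <= M -> 1 <= K ->
  alpha + beta * M + `|f| <= K -> `|v| <= M -> taylor_coeffs v a ->
  geo_bounded M K a.
Proof.
move=> M1 K1 leK vM [a0 aS]; apply: geo_bounded_rec; first by rewrite a0.
have M0 : 0 <= M by lra.
have K0 : 0 <= K by lra.
move=> n IH; rewrite aS.
have fn : `|if n == 0%N then f else 0| <= n.+1%:R * (M * K ^+ n) * `|f|.
  case: eqP => [->|_]; last by rewrite normr0 !mulr_ge0// exprn_ge0.
  by rewrite expr0 mul1r mulr1 ler_peMl.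
apply: le_trans (ler_normD _ _) _; apply: le_trans (lerD (ler_normB _ _) fn) _.
rewrite normrN; apply: le_trans (lerD (lerD (A_bound _) (conv_bound M0 M0 K0 IH IH)) (lexx _)) _.
apply: (@le_trans _ _ (n.+1%:R * (M * K ^+ n) * (alpha + beta * M + `|f|))); last first.
  rewrite exprS -mulrA ler_wpM2l// -mulrA ler_wpM2l// mulrC.
  by rewrite ler_wpM2r// exprn_ge0.
rewrite mulrDr lerD2r mulrDr lerD//; last first.
  by rewrite le_eqVlt; apply/orP; left; apply/eqP; ring.
rewrite mulrC ler_wpM2r//; apply: le_trans (IH n (leqnn n)) _.
by rewrite ler_peMl ?mulr_ge0 ?exprn_ge0// ler1n.
Qed.

Lemma variation_coeffs_bound M c K p q (g : nat -> V) (z0 : V) z : 0 <= M -> 0 <= c ->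
  alpha + 2 * beta * M + 1 <= K -> geo_bounded M K p -> geo_bounded M K q ->
  (forall n, `|g n| <= n.+1%:R * (c * K ^+ n)) -> `|z0| <= c ->
  variation_coeffs p q g z0 z -> geo_bounded c K z.
Proof.
move=> M0 c0 leK pM qM gc z0c [zE zS]; apply: geo_bounded_rec; first by rewrite zE.
have K0 : 0 <= K by apply: le_trans leK; rewrite addr_ge0// addr_ge0// !mulr_ge0.
move=> n IH; rewrite zS.
have cp := conv_bound M0 c0 K0 (fun i _ => pM i) IH.
have cq := conv_bound c0 M0 K0 IH (fun i _ => qM i).
apply: le_trans (ler_normD _ _) _; apply: le_trans (lerD (ler_normB _ _) (gc n)) _.
apply: le_trans (lerD (lerD (ler_normB _ _) cq) (lexx _)) _; rewrite normrN.
apply: le_trans (lerD (lerD (lerD (A_bound _) cp) (lexx _)) (lexx _)) _.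
apply: (@le_trans _ _ (n.+1%:R * (c * K ^+ n) * (alpha + 2 * beta * M + 1))); last first.
  rewrite exprS -mulrA ler_wpM2l// -mulrA ler_wpM2l// mulrC.
  by rewrite ler_wpM2r// exprn_ge0.
have : alpha * `|z n| <= n.+1%:R * (c * K ^+ n) * alpha.
  rewrite mulrC ler_wpM2r//; apply: le_trans (IH n (leqnn n)) _.
  by rewrite ler_peMl ?mulr_ge0 ?exprn_ge0// ler1n.
set x := alpha * _; set y := _ * alpha => xy; rewrite -!addrA.
apply: le_trans (lerD xy (lexx _)) _.
by rewrite le_eqVlt; apply/orP; left; apply/eqP; rewrite /y; ring.
Qed.

(** The coefficients of the derivative are those of the vector field evaluated
    along the series, by linearity and the Cauchy product. *)
Lemma taylor_solution M K v a t : 0 < K -> geo_bounded M K a ->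
  taylor_coeffs v a -> `|t| * (8 * K) < 1 ->
  is_derive t 1 (vseries a) (vfield A B f (vseries a t)).
Proof.
move=> K0 aMK [_ aS] tK; have := vseries_derive aMK K0 tK.
have tK8 : `|t| * K <= 1 / 8 by lra.
have tK2 : `|t| * (2 * K) < 1 by lra.
have tK1 : `|t| * K < 1 by lra.
have E : psum (vdiffs a) t = fun N => - A (psum a t N) - psum (conv a a) t N +
    (if N == 0%N then 0 else f).
  apply/funext => -[|N].
    by rewrite /psum !big_ord0 linear0 oppr0 !addr0.
  rewrite /= -psum_linear /psum; elim: N => [|N IH].
    by rewrite !big_ord1 expr0 !scale1r aS.
  rewrite big_ord_recr/= IH [in RHS]big_ord_recr/= (big_ord_recr N.+1)/= aS/= addr0.
  rewrite scalerBr scalerN !opprD; set x := - \sum_(i < _) _; set y := - \sum_(i < _) _.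
  by rewrite addrAC addrACA.
rewrite (vseries_unique (l := vfield A B f (vseries a t))
  (geo_bounded_diffs aMK (ltW K0)) _ tK2)//; first by rewrite mulr_ge0// ltW.
rewrite E /vfield; apply: cvgD.
  apply: cvgB; last exact: (psum_conv_cvg aMK aMK (ltW K0) tK8).
  apply: cvgN; apply: continuous_cvg; first exact: linear_rV_continuous.
  exact: psum_cvg aMK (ltW K0) tK1.
by apply: cvg_near_cst; exists 1%N => // -[].
Qed.

Lemma convBl a b c n : conv (fun i => a i - b i) c n = conv a c n - conv b c n.
Proof. by rewrite /conv -sumrB; apply: eq_bigr => i _; rewrite linearBl. Qed.

Lemma convBr a b c n : conv c (fun i => a i - b i) n = conv c a n - conv c b n.
Proof. by rewrite /conv -sumrB; apply: eq_bigr => i _; rewrite linearBr. Qed.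

Lemma variation_coeffs_sum p q (w : V) (z0 : 'I_d -> V) (z : 'I_d -> nat -> V) :
  (forall i, variation_coeffs p q (fun=> 0) (z0 i) (z i)) ->
  variation_coeffs p q (fun=> 0) (\sum_i w 0 i *: z0 i)
    (fun n => \sum_i w 0 i *: z i n).
Proof.
move=> zP; split; first by apply: eq_bigr => i _; case: (zP i) => ->.
move=> n; rewrite addr0 /vdiffs scaler_sumr linear_sum -sumrN.
have -> : conv p (fun n => \sum_i w 0 i *: z i n) n =
    \sum_i w 0 i *: conv p (z i) n.
  rewrite /conv; under eq_bigr => i _ do rewrite linear_sumr.
  rewrite exchange_big/=; apply: eq_bigr => i _; rewrite scaler_sumr.
  by apply: eq_bigr => j _; rewrite linearZr_LR.
have -> : conv (fun n => \sum_i w 0 i *: z i n) q n =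
    \sum_i w 0 i *: conv (z i) q n.
  rewrite /conv; under eq_bigr => i _ do rewrite linear_sumlz.
  rewrite exchange_big/=; apply: eq_bigr => i _; rewrite scaler_sumr.
  by apply: eq_bigr => j _; rewrite linearZl_LR.
rewrite -!sumrB; apply: eq_bigr => i _.
have [_ /(_ n)] := zP i; rewrite addr0 /vdiffs scalerA mulrC -scalerA => ->.
by rewrite [A (_ *: _)]linearZ_LR !scalerBr scalerN.
Qed.

Lemma taylor_coeffs_sub v v' a a' : taylor_coeffs v a -> taylor_coeffs v' a' ->
  variation_coeffs a' a (fun=> 0) (v' - v) (fun n => a' n - a n).
Proof.
move=> [a0 aS] [a0' aS']; split; first by rewrite a0 a0'.
move=> n; rewrite /vdiffs scalerBr -!/(vdiffs _ _) aS aS' convBr convBl linearB/=.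
rewrite addr0; set x := conv a' a' n; set y := conv a' a n; set z := conv a a n.
set k := if _ then _ else _; rewrite -(addrA _ k) -!addrA.
by apply/rowP => i; rewrite !mxE; ring.
Qed.

(** The remainder of the first-order expansion starts at 0 and is driven by the
    quadratic term B (x' - x, x' - x) only. *)
Lemma taylor_coeffs_remainder v v' a a' z :
  taylor_coeffs v a -> taylor_coeffs v' a' ->
  variation_coeffs a a (fun=> 0) (v' - v) z ->
  variation_coeffs a a
    (fun n => - conv (fun i => a' i - a i) (fun i => a' i - a i) n) 0
    (fun n => a' n - a n - z n).
Proof.
move=> [a0 aS] [a0' aS'] [z_0 zS]; split; first by rewrite a0 a0' z_0 subrr.
move=> n; rewrite /vdiffs !scalerBr -!/(vdiffs _ _) aS aS' zS.
rewrite !(convBr, convBl) !linearB/=.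
by apply/rowP => i; rewrite !mxE; ring.
Qed.

Lemma vseries_sub Ma Mb K a b t : geo_bounded Ma K a -> geo_bounded Mb K b ->
  0 <= K -> `|t| * K < 1 ->
  vseries (fun n => a n - b n) t = vseries a t - vseries b t.
Proof.
move=> aK bK K0 tK; apply: (@vseries_unique _ _ (Ma + Mb) K) => //.
  by move=> n; apply: le_trans (ler_normB _ _) _; rewrite mulrDl lerD.
rewrite (_ : psum _ t = fun N => psum a t N - psum b t N).
  by apply: cvgB; [exact: psum_cvg aK K0 tK|exact: psum_cvg bK K0 tK].
by apply/funext => N; rewrite /psum -sumrB; apply: eq_bigr => i _; rewrite scalerBr.
Qed.

Lemma vseries_sum M K (w : V) (z : 'I_d -> nat -> V) t :
  (forall i, geo_bounded M K (z i)) -> 0 <= K -> `|t| * K < 1 ->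
  vseries (fun n => \sum_i w 0 i *: z i n) t = \sum_i w 0 i *: vseries (z i) t.
Proof.
move=> zK K0 tK; apply: (@vseries_unique _ _ (\sum_i `|w 0 i| * M) K) => //.
  move=> n; apply: le_trans (ler_norm_sum _ _ _) _; rewrite mulr_suml.
  by apply: ler_sum => i _; rewrite normrZ -mulrA ler_wpM2l//; exact: zK.
rewrite (_ : psum _ t = fun N => \sum_i w 0 i *: psum (z i) t N).
  apply: cvg_big => [|i _]; first exact: add_continuous.
  by apply: cvgZl_tmp; exact: psum_cvg (zK i) K0 tK.
apply/funext => N; rewrite /psum; under eq_bigr => i _ do rewrite scaler_sumr.
rewrite exchange_big/=; apply: eq_bigr => i _; rewrite scaler_sumr.
by apply: eq_bigr => j _; rewrite !scalerA mulrC.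
Qed.

(** D is the matrix whose rows are the variations of the solution in the
    coordinate directions.  The difference of two solutions is of order
    |v' - v|, so the source of the remainder, and the remainder itself, are of
    order |v' - v|^2. *)
Lemma taylor_series_expansion M K v a t : 0 <= M -> 0 <= K ->
  alpha + 2 * beta * M + 1 <= K -> `|t| * K <= 1 / 2 ->
  geo_bounded M K a -> taylor_coeffs v a ->
  exists D : 'M[R]_d, forall v' a', geo_bounded M K a' -> taylor_coeffs v' a' ->
    `|vseries a' t - vseries a t - (v' - v) *m D| <= 2 * (beta * `|v' - v| ^+ 2).
Proof.
move=> M0 K0 leK tK aK av.
have tK1 : `|t| * K < 1 by lra.
have /choice[z zP] (i : 'I_d) :
  exists z, variation_coeffs a a (fun=> 0) (delta_mx 0 i) z.
  exact: variation_coeffs_exist.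
have g0 c n : 0 <= c -> `|(fun _ : nat => 0 : V) n| <= n.+1%:R * (c * K ^+ n).
  by move=> c0; rewrite normr0 !mulr_ge0// exprn_ge0.
have zK i : geo_bounded 1 K (z i).
  apply: (variation_coeffs_bound M0 ler01 leK aK aK _ _ (zP i)).
    by move=> n; exact: g0.
  exact: norm_delta_mx.
exists (\matrix_(i, k) vseries (z i) t 0 k) => v' a' aK' av'.
pose zw n := \sum_i (v' - v) 0 i *: z i n.
have zwP : variation_coeffs a a (fun=> 0) (v' - v) zw.
  by rewrite [X in variation_coeffs _ _ _ X](row_sum_delta (v' - v)); exact: variation_coeffs_sum.
have c0 : 0 <= `|v' - v| by [].
have zwK : geo_bounded `|v' - v| K zw.
  by apply: (variation_coeffs_bound M0 c0 leK aK aK _ _ zwP) => // n; exact: g0.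
have dK : geo_bounded `|v' - v| K (fun n => a' n - a n).
  apply: (variation_coeffs_bound M0 c0 leK aK' aK _ _ (taylor_coeffs_sub av av')) => // n.
  exact: g0.
have cc0 : 0 <= beta * `|v' - v| ^+ 2 by rewrite mulr_ge0// exprn_ge0.
have eK : geo_bounded (beta * `|v' - v| ^+ 2) K (fun n => a' n - a n - zw n).
  apply: (variation_coeffs_bound M0 cc0 leK aK aK _ _
    (taylor_coeffs_remainder av av' zwP)); last by rewrite normr0.
  move=> n; rewrite normrN.
  have := @conv_bound `|v' - v| `|v' - v| K _ _ n c0 c0 K0
    (fun i _ => dK i) (fun i _ => dK i).
  by rewrite -(mulrA beta) -expr2.
have := vseries_bound eK K0 tK.
rewrite (vseries_sub dK zwK K0 tK1) (vseries_sub aK' aK K0 tK1).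
rewrite (vseries_sum _ zK K0 tK1) mulmx_sum_row.
rewrite (_ : \sum_i (v' - v) 0 i *: row i _ = \sum_i (v' - v) 0 i *: vseries (z i) t)//.
apply: eq_bigr => i _; congr (_ *: _); apply/rowP => k; by rewrite !mxE.
Qed.

End quadratic_series.

(** * Differentiability in the initial point for short times *)

Lemma quadratic_remainder_differentiable (R : realType) (V W : normedModType R)
    (g : V -> W) (v : V) (L : {linear V -> W}) (c rho : R) :
  0 < rho -> 0 <= c -> continuous L ->
  (forall v', `|v' - v| <= rho ->
    `|g v' - g v - L (v' - v)| <= c * `|v' - v| ^+ 2) ->
  differentiable g v.
Proof.
move=> rho0 c0 cL gL.
have E : g \o shift v = cst (g v) + L +o_ 0 id.
  apply/eqaddoP => e e0; near=> w => /=.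
  have wrho : `|w| <= rho by near: w; exact: nbhs0_le.
  have wc : `|w| <= e / (c + 1) by near: w; apply: nbhs0_le; rewrite divr_gt0//; lra.
  have := gL (w + v); rewrite addrK => /(_ wrho) gLw.
  rewrite (_ : (_ - _) w = g (w + v) - g v - L w); last first.
    by rewrite !fctE/= opprD addrA.
  apply: le_trans gLw _; rewrite expr2 mulrA ler_wpM2r//.
  rewrite ler_pdivlMr in wc; last by lra.
  by apply: le_trans wc; rewrite mulrC ler_wpM2l//; lra.
apply/diff_locallyP; rewrite (diff_unique cL E); split=> //; exact: cL.
Unshelve. all: by end_near. Qed.

Section local_flow.
Context {R : realType} {d : nat}.
Local Notation V := 'rV[R]_d.
Variables (A : {linear V -> V}) (B : {bilinear V -> V -> V}) (f : V).

(** Existence time and differentiability are uniform on balls; solutions are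
    produced for negative times as well. *)
Lemma uniform_local_solution (rho : R) : 0 <= rho ->
  exists2 tau : R, 0 < tau &
    exists x : V -> R -> V,
    [/\ forall v : V, `|v| <= rho -> x v 0 = v,
        forall (v : V) (t : R), `|v| <= rho -> `|t| < tau ->
          is_derive t 1 (x v) (vfield A B f (x v t)) &
        forall (v : V) (t : R), `|v| < rho -> `|t| < tau -> differentiable (x ^~ t) v].
Proof.
move=> rho0.
have [alpha alpha0 Aalpha] := linear_rV_bound A.
have [beta beta0 Bbeta] := bilinear_rV_bound B.
(* M >= 1 lets the geometric bound absorb f; the rate K dominates the
   constants of both the nonlinear and the linearised recursions. *)
pose M := rho + 1; pose K := alpha + 2 * beta * M + `|f| + 1.
have M1 : 1 <= M by rewrite /M; lra.
have bM : 0 <= beta * M by rewrite mulr_ge0//; lra.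
have f0 : 0 <= `|f| by [].
have K1 : 1 <= K by rewrite /K; lra.
have leK1 : alpha + beta * M + `|f| <= K by rewrite /K; lra.
have leK2 : alpha + 2 * beta * M + 1 <= K by rewrite /K; lra.
have K0 : 0 < K by lra.
have /choice[a aP] (v : V) : exists a, taylor_coeffs A B f v a.
  exact: taylor_coeffs_exist.
have aK v : `|v| <= rho -> geo_bounded M K (a v).
  move=> vrho; apply: (taylor_coeffs_bound alpha0 beta0 Aalpha Bbeta) (aP v) => //.
  by rewrite /M; lra.
have tauK t : `|t| < (8 * K)^-1 -> `|t| * (8 * K) < 1.
  by rewrite -[_^-1]mul1r ltr_pdivlMr// mulr_gt0.
exists (8 * K)^-1; first by rewrite invr_gt0 mulr_gt0.
exists (fun v => vseries (a v)); split.
- by move=> v _; rewrite vseries0; case: (aP v).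
- by move=> v t /aK aKv /tauK; exact: (taylor_solution K0 aKv (aP v)).
- move=> v t vrho /tauK tK; have tK2 : `|t| * K <= 1 / 2 by lra.
  have [|D DP] := taylor_series_expansion alpha0 beta0 Aalpha Bbeta _ (ltW K0)
    leK2 tK2 (aK _ (ltW vrho)) (aP v); first by lra.
  apply: (@quadratic_remainder_differentiable _ _ _ _ _ (mulmxr D : {linear V -> V})
    (2 * beta) (rho - `|v|)).
  + by rewrite subr_gt0.
  + by rewrite mulr_ge0.
  + exact: linear_rV_continuous.
  + move=> v' vv'; rewrite -mulrA; apply: DP (aP v'); apply: aK.
    by rewrite -(subrK v v') (le_trans (ler_normD _ _))// -lerBrDr.
Qed.

End local_flow.

(** * Differentiability of the flow and of its inverse *)

(** The differential is a local notion; this transfers it from the power series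
    and from the iterates to the flow maps. *)
Lemma near_eq_diff (R : realType) (V W : normedModType R) (f g : V -> W) (v : V) :
  {near v, f =1 g} -> differentiable f v ->
  differentiable g v /\ 'd g v = 'd f v :> (V -> W).
Proof.
move=> fg df; have fgv : f v = g v by exact: nbhs_singleton fg.
have cf : continuous ('d f v) by exact: diff_continuous.
have E : g \o shift v = cst (g v) + 'd f v +o_ 0 id.
  apply/eqaddoP => e e0; have /eqaddoP/(_ e e0) := diff_locally df.
  have : \forall w \near 0, f (w + v) = g (w + v).
    by move: fg; rewrite (near_shift 0 v) subr0.
  apply: filterS2 => w fgw.
  by rewrite !fctE/= fgw fgv.
have dE := diff_unique cf E; split; last exact: dE.
by apply/diff_locallyP; rewrite dE.
Qed.

(** Chain rule along an orbit p of phi.  That psi is a right inverse of phi near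
    each point of the orbit makes the iterate of psi a right inverse of the
    iterate of phi near the last point. *)
Lemma iter_inverse_differentiable (R : realType) (V : normedModType R)
    (phi psi : V -> V) (p : nat -> V) N :
  (forall n, p n.+1 = phi (p n)) ->
  (forall n, (n < N)%N -> psi (p n.+1) = p n) ->
  (forall n, (n < N)%N -> differentiable phi (p n)) ->
  (forall n, (n < N)%N -> differentiable psi (p n.+1)) ->
  (forall n, (n < N)%N -> \forall w \near p n.+1, phi (psi w) = w) ->
  [/\ differentiable (iter N phi) (p 0%N), differentiable (iter N psi) (p N),
      iter N psi (p N) = p 0%N &
      \forall w \near p N, iter N phi (iter N psi w) = w].
Proof.
move=> pS; elim: N => [|N IH] psip dphi dpsi phipsi.
  by split=> //; near=> w.
have [||||d1 d2 e3 n4] := IH; first by move=> n nN; apply: psip; exact: ltnW.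
- by move=> n nN; apply: dphi; exact: ltnW.
- by move=> n nN; apply: dpsi; exact: ltnW.
- by move=> n nN; apply: phipsi; exact: ltnW.
have iterp n : iter n phi (p 0%N) = p n by elim: n => //= n ->; rewrite pS.
have psipN := psip N (ltnSn N).
split.
- rewrite (_ : iter N.+1 phi = phi \o iter N phi)//.
  by apply: differentiable_comp => //; rewrite iterp; exact: dphi.
- rewrite (_ : iter N.+1 psi = iter N psi \o psi); last first.
    by apply/funext => w; rewrite iterSr.
  by apply: differentiable_comp; [exact: dpsi|rewrite psipN].
- by rewrite iterSr psipN.
- have cpsi : {for p N.+1, continuous psi}.
    by apply: differentiable_continuous; exact: dpsi.
  have n4' : \forall w \near p N.+1, iter N phi (iter N psi (psi w)) = psi w.
    by move: n4; rewrite -psipN => /cpsi.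
  apply: filterS2 n4' (phipsi N (ltnSn N)) => w e1 e2.
  by rewrite [iter N.+1 psi w]iterSr iterS e1.
Unshelve. all: by end_near. Qed.

Lemma diff_left_inverse (R : realType) (V W : normedModType R) (phi : V -> W)
    (psi : W -> V) (v : V) :
  differentiable phi v -> differentiable psi (phi v) ->
  (\forall w \near v, psi (phi w) = w) ->
  forall w, 'd psi (phi v) ('d phi v w) = w.
Proof.
move=> dphi dpsi psiK w.
have nid : {near v, id =1 psi \o phi} by apply: filterS psiK.
have [_ dcomp] := near_eq_diff nid (ex_diff (is_diff_def := is_diff_id v)).
have e1 := congr1 (fun h : V -> V => h w) (diff_comp dphi dpsi).
have e2 := congr1 (fun h : V -> V => h w) dcomp.
have e3 := congr1 (fun h : V -> V => h w) (diff_val (is_diff_def := is_diff_id v)).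
exact: etrans (esym e1) (etrans e2 e3).
Qed.

Lemma jacobian_left_inverse (R : realType) d (phi psi : 'rV[R]_d -> 'rV[R]_d) v :
  differentiable phi v -> differentiable psi (phi v) ->
  (\forall w \near v, psi (phi w) = w) ->
  \det ('J phi v) * \det ('J psi (phi v)) = 1.
Proof.
move=> dphi dpsi psiK; have dK := diff_left_inverse dphi dpsi psiK.
rewrite -det_mulmx.
suff -> : 'J phi v *m 'J psi (phi v) = 1%:M by rewrite det1.
apply/row_matrixP => i; rewrite !rowE mulmxA mulmx1.
by rewrite -(deriveEjacobian _ dphi) -(deriveEjacobian _ dpsi) !deriveE.
Qed.

Section flow.
Context {R : realType} {d : nat}.
Local Notation V := 'rV[R]_d.
Variables (A : {linear V -> V}) (B : {bilinear V -> V -> V}) (f : V).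
Variables (r : R) (Psi : R -> V -> V).
Hypothesis flowP : is_flow A B f r Psi.

(** Any solution, on an interval of either orientation, is followed by Psi from
    each of its points: translate time so that the starting point is at 0. *)
Lemma flow_along (x : R -> V) (a b : R) :
  (forall s, Num.min a b <= s <= Num.max a b ->
     is_derive s 1 x (vfield A B f (x s))) ->
  Psi (b - a) (x a) = x b.
Proof.
move=> xP; have xsP s : Num.min 0 (b - a) <= s <= Num.max 0 (b - a) ->
    is_derive s 1 (fun s => x (s + a)) (vfield A B f (x (s + a))).
  move=> sab; have /xP [dx Dx] : Num.min a b <= s + a <= Num.max a b.
    move: sab; rewrite -lerBlDr -[_ + a <= _]lerBrDr.
    by rewrite addr_minl addr_maxl subrr.
  have E : (fun h : R => h^-1 *: (((fun s => x (s + a)) \o shift s) (h *: 1)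
      - x (s + a))) =
    (fun h => h^-1 *: ((x \o shift (s + a)) (h *: 1) - x (s + a))).
    by apply/funext => h; rewrite /= addrA.
  by split; rewrite /derivable /derive E.
rewrite (flowP.1 (x a) (b - a) (fun s => x (s + a))) ?subrK//; split.
- by rewrite add0r.
- apply: derivable_within_continuous => s; rewrite in_itv/= => /xsP[].
  by [].
- move=> s; rewrite in_itv/= => /andP[s1 s2]; apply: xsP.
  by rewrite !ltW.
Qed.

Lemma flow0 v : ball2 r v -> Psi 0 v = v.
Proof. by move=> rv; have [] := flowP.2 v 0 rv (lexx _). Qed.

Lemma flow_add v s t : ball2 r v -> 0 <= s -> 0 <= t ->
  Psi (t + s) v = Psi t (Psi s v).
Proof.
move=> rv; rewrite le_eqVlt => /predU1P[<-|s0] t0; first by rewrite flow0// addr0.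
have <- : Psi (t + s - s) (Psi s v) = Psi (t + s) v; last by rewrite addrK.
apply: (@flow_along (Psi ^~ v)) => x.
have sts : s <= t + s by rewrite lerDr.
rewrite min_l// max_r// => /andP[sx xts].
have ts0 : 0 <= t + s + 1 by rewrite !addr_ge0// ltW.
have [_ _] := flowP.2 v (t + s + 1) rv ts0; apply.
rewrite in_itv/= min_l// max_r// (lt_le_trans s0 sx)/=.
by rewrite (le_lt_trans xts)// ltrDl.
Qed.

Lemma flow_iter v s n : ball2 r v -> 0 <= s ->
  Psi (n%:R * s) v = iter n (Psi s) v.
Proof.
move=> rv s0; elim: n => [|n IH]; first by rewrite mul0r flow0.
by rewrite iterS -IH -flow_add ?mulr_ge0// -nat1r mulrDl mul1r.
Qed.

Lemma flow_bounded v T : ball2 r v -> 0 <= T ->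
  exists2 rho : R, 0 <= rho & forall s, 0 <= s <= T -> `|Psi s v| <= rho.
Proof.
move=> rv T0; have [_ + _] := flowP.2 v T rv T0; rewrite min_l// max_r// => cPsi.
have [M [_ MP]] := compact_bounded (continuous_compact cPsi (@segment_compact _ _ _)).
exists (`|M| + 1); first by rewrite addr_ge0.
move=> s sT; apply: (MP (`|M| + 1)) => /=.
  by rewrite (le_lt_trans (ler_norm _))// ltrDl.
by exists s => //=; rewrite in_itv.
Qed.

(** Near Psi T v the map Psi (- T) is identified as follows.  Let psi be the
    time step - T / N.  For w near Psi T v, the point w' = psi^N w is near v,
    hence in the ball, and Psi T w' = w because each step of psi is inverted by
    the opposite step; so Psi (- T) w = w'. *)
Lemma flow_differentiable v T : nbhs v (ball2 r : set V) -> 0 <= T ->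
  differentiable (Psi T) v /\ differentiable (Psi (- T)) (Psi T v).
Proof.
move=> nv T0; have rv : ball2 r v by exact: nbhs_singleton.
have [rho0 rho00 Prho0] := flow_bounded rv T0.
(* The margin 1 keeps the orbit in the open ball of radius rho. *)
pose rho := rho0 + 1; have rho_ge0 : 0 <= rho by rewrite /rho; lra.
have [tau tau0 [x [x0 xsol xdiff]]] := uniform_local_solution A B f rho_ge0.
have PsiE (w : V) (t : R) : `|w| <= rho -> `|t| < tau -> Psi t w = x w t.
  move=> wrho tt; rewrite -{1}(subr0 t) -[w in LHS](x0 w wrho); apply: flow_along.
  move=> s /andP[s1 s2]; apply: xsol => //.
  move: tt s1 s2; rewrite !ltr_norml => /andP[t1 t2]; rewrite ge_min le_max.
  by move=> /orP[] s1 /orP[] s2; apply/andP; split; lra.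
have PsiN (w : V) (t : R) : `|w| <= rho -> `|t| < tau -> Psi (- t) (Psi t w) = w.
  move=> wrho tt; rewrite (PsiE w t)// -sub0r -[RHS](x0 w wrho); apply: flow_along.
  move=> s /andP[s1 s2]; apply: xsol => //.
  move: tt s1 s2; rewrite !ltr_norml => /andP[t1 t2]; rewrite ge_min le_max.
  by move=> /orP[] s1 /orP[] s2; apply/andP; split; lra.
have near_small (w : V) : `|w| < rho -> \forall z \near w, `|z| <= rho.
  move=> wrho; have e0 : 0 < rho - `|w| by rewrite subr_gt0.
  have := @nbhs0_le _ V _ e0; rewrite (near_shift w) sub0r.
  apply: filterS => z /= zw; rewrite -(subrK w z) (le_trans (ler_normD _ _))//.
  by rewrite -lerBrDr.
have Psid (w : V) (t : R) : `|w| < rho -> `|t| < tau -> differentiable (Psi t) w.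
  move=> wrho tt; have [] // := @near_eq_diff _ _ _ (x ^~ t) (Psi t) w _ (xdiff w t wrho tt).
  by near=> z; rewrite PsiE//; near: z; exact: near_small.
(* N steps of length less than tau, so that each step is given by the series. *)
pose N := (Num.truncn (T / tau)).+1; pose s := T / N%:R.
have N0 : 0 < N%:R :> R by rewrite ltr0n.
have s0 : 0 <= s by rewrite divr_ge0// ltW.
have stau : `|s| < tau.
  by rewrite ger0_norm// ltr_pdivrMr// mulrC -ltr_pdivrMr// truncnS_gt.
have NsT : N%:R * s = T by rewrite mulrC divfK// gt_eqF.
have itE n w : ball2 r w -> iter n (Psi s) w = Psi (n%:R * s) w.
  by move=> rw; rewrite flow_iter.
have prho n : (n <= N)%N -> `|iter n (Psi s) v| < rho.
  move=> nN; rewrite itE// (@le_lt_trans _ _ rho0)//; last by rewrite ltrDl.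
  by apply: Prho0; rewrite mulr_ge0//= -NsT ler_wpM2r// ler_nat.
have [||||d1 d2 e3 n4] := @iter_inverse_differentiable _ _ (Psi s) (Psi (- s))
    (fun n => iter n (Psi s) v) N (fun n => iterS n (Psi s) v).
- by move=> n nN; rewrite PsiN// ltW// prho// ltnW.
- by move=> n nN; apply: Psid => //; apply: prho; exact: ltnW.
- by move=> n nN; apply: Psid; [exact: prho|rewrite normrN].
- move=> n nN; near=> w; rewrite -{1}(opprK s) PsiN ?normrN//.
  by near: w; apply: near_small; exact: prho.
rewrite itE// NsT in d2 e3 n4.
have near_iter : {near v, iter N (Psi s) =1 Psi T}.
  by apply: filterS nv => w rw; rewrite itE// NsT.
split; first by have [] := near_eq_diff near_iter d1.
have n5 : \forall w \near Psi T v, ball2 r (iter N (Psi (- s)) w).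
  by move: nv; rewrite -[v in nbhs v _]e3 => /(differentiable_continuous d2).
have [] // := @near_eq_diff _ _ _ _ (Psi (- T)) _ _ d2.
near=> w; have rw : ball2 r (iter N (Psi (- s)) w) by near: w.
have wE : iter N (Psi s) (iter N (Psi (- s)) w) = w by near: w.
by rewrite -[in RHS]wE itE// NsT (flow_inverse flowP).
Unshelve. all: by end_near. Qed.

Lemma flow_jacobian_inverse v T : nbhs v (ball2 r : set V) -> 0 <= T ->
  \det ('J (Psi T) v) * \det ('J (Psi (- T)) (Psi T v)) = 1.
Proof.
move=> nv T0; have [d1 d2] := flow_differentiable nv T0.
apply: jacobian_left_inverse => //.
by apply: filterS nv => w rw; exact: (flow_inverse flowP).
Qed.

End flow.

(** * Reflection invariance of the Gaussian distribution *)

Section reflection.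
Context {R : realType}.

Definition rV_opp n (v : borel R n) : borel R n := - (v : 'rV[R]_n).

Lemma measurable_rV_opp n : measurable_fun [set: borel R n] (@rV_opp n).
Proof.
apply: measurable_fun_borel => i.
rewrite (_ : (fun v => _) = (fun v : borel R n => - (v : 'rV[R]_n) 0 i)).
  exact: measurableT_comp (measurable_borel_coord i).
by apply/funext => v; rewrite mxE.
Qed.

HB.instance Definition _ n :=
  isMeasurableFun.Build _ _ _ _ (@rV_opp n) (@measurable_rV_opp n).

Lemma ge0_integral_opp (g : measurableTypeR R -> \bar R) :
  measurable_fun setT g -> (forall x, (0 <= g x)%E) ->
  (\int[@lebesgue_measure R]_x g (- x)%R = \int[@lebesgue_measure R]_x g x)%E.
Proof.
move=> mg g0.
have mN : measurable_fun setT (-%R : measurableTypeR R -> measurableTypeR R).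
  exact: oppr_measurable.
have := @ge0_integral_pushforward _ _ _ _ R _ mN
  lebesgue_measure setT g measurableT mg (fun x _ => g0 x).
rewrite preimage_setT => <-//.
by apply: eq_measure_integral => S mS _; exact: lebesgue_measureN.
Qed.

Lemma cons_rV_opp n (x : R) (w : borel R n) :
  cons_rV (- x, rV_opp w) = rV_opp (cons_rV (x, w)).
Proof.
transitivity (row_mx (- (const_mx x : 'rV[R]_1)) (- (w : 'rV[R]_n))).
  apply: (f_equal2 (@row_mx R 1 1 n)) => //.
  by apply/rowP => i; rewrite !mxE.
exact: (esym (opp_row_mx (const_mx x : 'rV[R]_1) (w : 'rV[R]_n))).
Qed.

(** Induction on the dimension: the measure is an iterated product, the
    reflection acts on the sections by the induction hypothesis and on the first
    coordinate by the invariance of the Lebesgue measure of the line. *)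
Lemma lebesgue_rV_opp n (S : set (borel R n)) : measurable S ->
  lebesgue_rV n (@rV_opp n @^-1` S) = lebesgue_rV n S.
Proof.
elim: n S => [|n IH] S mS.
  congr (lebesgue_rV 0 _); apply/funext => v; congr S.
  by apply/rowP => -[].
have mcS : measurable (@cons_rV R n @^-1` S).
  by rewrite -[X in measurable X]setTI; exact: measurable_cons_rV.
rewrite /= /lebesgue_cons /pushforward /product_measure1.
rewrite -[RHS](@ge0_integral_opp); last 2 first.
  exact: measurable_fun_xsection.
  by move=> x; exact: measure_ge0.
have mx y : measurable (xsection (@cons_rV R n @^-1` S) y).
  exact: measurable_xsection.
apply: eq_integral => x _; rewrite /= -(IH _ (mx _)).
congr (lebesgue_rV n _); apply/seteqP; split=> w /=; rewrite /xsection/= !inE/=;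
  suff -> : cons_rV (- x, rV_opp w) = rV_opp (cons_rV (x, w)) by [].
all: exact: cons_rV_opp.
Qed.

Lemma measurable_gauss_pdf n :
  measurable_fun setT (@gauss_pdf R n : borel R n -> R).
Proof.
apply: measurable_funM => //; apply: measurableT_comp => //.
apply: measurableT_comp => //; apply: measurable_funM => //.
apply: measurable_funX; rewrite /norm2; apply: measurableT_comp => //.
  by apply: continuous_measurable_fun; exact: sqrt_continuous.
rewrite /dot2; apply: measurable_sum => i.
by apply: measurable_funM; exact: measurable_borel_coord.
Qed.

Lemma gauss_pdf_ge0 n (z : 'rV[R]_n) : 0 <= gauss_pdf z.
Proof. by rewrite mulr_ge0 ?expR_ge0// invr_ge0 exprn_ge0// sqrtr_ge0. Qed.

Lemma gauss_pdf_opp n (z : 'rV[R]_n) : gauss_pdf (- z) = gauss_pdf z.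
Proof.
rewrite /gauss_pdf /norm2 (_ : dot2 (- z) (- z) = dot2 z z)//.
by apply: eq_bigr => i _; rewrite mxE mulrNN.
Qed.

Lemma gauss_integral_opp n (S : set (borel R n)) : measurable S ->
  (\int[lebesgue_rV n]_(z in @rV_opp n @^-1` S) (gauss_pdf z)%:E =
   \int[lebesgue_rV n]_(z in S) (gauss_pdf z)%:E)%E.
Proof.
move=> mS.
have mg : measurable_fun S (fun z : borel R n => (gauss_pdf z)%:E).
  apply/measurable_EFinP.
  exact: (measurable_funS measurableT (@subsetT _ S) (@measurable_gauss_pdf n)).
have g0 : {in S, forall z : borel R n, (0 <= (gauss_pdf z)%:E)%E}.
  by move=> z _; rewrite lee_fin gauss_pdf_ge0.
pose nu := pushforward (lebesgue_rV n) (@rV_opp n).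
transitivity (\int[nu]_(z in S) (gauss_pdf z)%:E)%E; last first.
  apply: eq_measure_integral => S' mS' _.
  exact: lebesgue_rV_opp.
apply/esym; apply: etrans (ge0_integral_pushforward (@measurable_rV_opp n) _ mS mg g0) _.
apply: eq_integral => z _; congr (_%:E); exact: gauss_pdf_opp.
Qed.

End reflection.

(** * Sums of independent symmetric random variables *)

Section symmetric_sum.
Context {R : realType}.

Definition boxes n : set (set 'rV[R]_n) :=
  [set S | exists2 A : 'I_n -> set R, (forall i, measurable (A i)) &
     S = [set v : 'rV[R]_n | forall i, A i (v 0 i)]].

(** The sigma-algebra generated by measurable boxes.  It makes coordinates
    measurable, and laws on it are determined by their values on boxes, which
    form a pi-system. *)
Definition box_rV n := g_sigma_algebraType (@boxes n).

Lemma measurable_fun_box d (T : measurableType d) n (W : T -> box_rV n) :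
  (forall i, measurable_fun setT (fun w => (W w : 'rV[R]_n) 0 i)) ->
  measurable_fun setT W.
Proof.
move=> mW; apply: (@measurability _ _ T (box_rV n) setT W (@boxes n) erefl).
move=> _ [_ [A mA ->] <-]; rewrite setTI.
rewrite (_ : _ @^-1` _ =
  \bigcap_(i : 'I_n) ((fun w => (W w : 'rV[R]_n) 0 i) @^-1` A i)).
  apply: fin_bigcap_measurable => //= i _.
  by rewrite -[X in measurable X]setTI; exact: mW.
by apply/seteqP; split=> w /= h i => [_|]; exact: h.
Qed.

Lemma measurable_box_coord n (i : 'I_n) :
  measurable_fun setT (fun v : box_rV n => (v : 'rV[R]_n) 0 i).
Proof.
move=> _ S mS; rewrite setTI; apply: sub_sigma_algebra.
exists (fun j => if j == i then S else setT).
  by move=> j; case: ifP => _ //; exact: measurableT.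
apply/seteqP; split=> v /= h; last by have := h i; rewrite eqxx.
by move=> j; case: eqP => // ->.
Qed.

(** The hypothesis says that X and - X have the same law on boxes, hence the same
    law.  The events that the sum is >= 0 and <= 0 then have equal probability
    and cover the space. *)
Lemma symmetric_sum_ge0 d (T : measurableType d) (P : probability T R) n
    (X : 'I_n -> T -> R) :
  (forall i, measurable_fun setT (X i)) ->
  (forall A : 'I_n -> set R, (forall i, measurable (A i)) ->
     P [set w | forall i, A i (X i w)] = P [set w | forall i, A i (- X i w)]) ->
  ((1 / 2)%:E <= P [set w | 0 <= \sum_i X i w]%R)%E.
Proof.
move=> mX symX.
pose W w : box_rV n := \row_i X i w; pose W' w : box_rV n := \row_i - X i w.
have mW : measurable_fun setT W.
  apply: measurable_fun_box => i.
  by rewrite (_ : (fun w => _) = X i)//; apply/funext => w; rewrite mxE.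
have mW' : measurable_fun setT W'.
  apply: measurable_fun_box => i; rewrite (_ : (fun w => _) = (fun w => - X i w)).
    exact: measurableT_comp (mX i).
  by apply/funext => w; rewrite mxE.
pose Wm : {mfun T >-> box_rV n} := HB.pack W (isMeasurableFun.Build _ _ _ _ W mW).
pose Wm' : {mfun T >-> box_rV n} := HB.pack W' (isMeasurableFun.Build _ _ _ _ W' mW').
have boxT : boxes [set: 'rV[R]_n].
  exists (fun=> setT); first by move=> i; exact: measurableT.
  by apply/seteqP; split.
pose S : set (box_rV n) := [set v | 0 <= \sum_i (v : 'rV[R]_n) 0 i].
have mS : measurable S.
  rewrite (_ : S = setT `&` (fun v : box_rV n => \sum_i (v : 'rV[R]_n) 0 i) @^-1` `[0, +oo[).
    apply: (measurable_sum (index_enum 'I_n) (@measurable_box_coord n)) => //.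
  by rewrite setTI; apply/seteqP; split=> v /=; rewrite in_itv/= andbT.
have E : P (W @^-1` S) = P (W' @^-1` S).
  apply: (@measure_unique _ R (box_rV n) (@boxes n) (fun=> setT) erefl _ _ _
    (distribution P Wm) (distribution P Wm') _ _ S mS) => //.
  - move=> _ _ [A mA ->] [A' mA' ->]; exists (fun i => A i `&` A' i).
      by move=> i; exact: measurableI.
    by apply/seteqP; split=> v /= => [[h1 h2] i|h]; [split|split=> i; case: (h i)].
  - by apply/seteqP; split=> // v _; exists 0%N.
  - move=> _ [A mA ->].
    have e1 : W @^-1` [set v : 'rV[R]_n | forall i, A i (v 0 i)] = [set w | forall i, A i (X i w)].
      by apply/seteqP; split=> w /= h i; have := h i; rewrite mxE.
    have e2 : W' @^-1` [set v : 'rV[R]_n | forall i, A i (v 0 i)] = [set w | forall i, A i (- X i w)].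
      by apply/seteqP; split=> w /= h i; have := h i; rewrite mxE.
    by have := symX A mA; rewrite -e1 -e2.
  - by move=> k; rewrite -ge0_fin_numE// fin_num_measure.
have WS : W @^-1` S = [set w | 0 <= \sum_i X i w].
  apply/funext => w; rewrite /S /preimage /mkset; congr (is_true (0 <= _)).
  by apply: eq_bigr => i _; rewrite mxE.
have W'S : W' @^-1` S = [set w | \sum_i X i w <= 0].
  apply/funext => w; rewrite /S /preimage /mkset -oppr_ge0 -sumrN.
  by congr (is_true (0 <= _)); apply: eq_bigr => i _; rewrite mxE.
have mWS : measurable (W @^-1` S) by rewrite -[X in measurable X]setTI; exact: (mW measurableT S mS).
have mWS' : measurable (W' @^-1` S) by rewrite -[X in measurable X]setTI; exact: (mW' measurableT S mS).
have cover : [set: T] = W @^-1` S `|` W' @^-1` S.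
  rewrite WS W'S; apply/seteqP; split=> // w _ /=.
  by have [] := leP 0 (\sum_i X i w); [left|move/ltW; right].
have le1 : (1 <= P (W @^-1` S) + P (W' @^-1` S))%E.
  by rewrite -(probability_setT P) cover; exact: measureU2.
rewrite -E WS in le1.
have Pfin : P [set w | 0 <= \sum_i X i w] \is a fin_num.
  by rewrite -WS; exact: fin_num_measure.
move: le1; rewrite -(fineK Pfin) -EFinD !lee_fin => le1; lra.
Qed.

End symmetric_sum.

Section gaussian_symmetry.
Context {R : realType} {o : nat} {disp : measure_display}
  {T : measurableType disp} (P : probability T R).
Variables (eps : R) (Z : nat -> {RV P >-> borel R o}).
Hypotheses (eps0 : 0 < eps) (gZ : gaussian_noise eps Z).

Lemma noise_opp i (S : set (borel R o)) : measurable S ->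
  P (Z i @^-1` (@rV_opp R o @^-1` S)) = P (Z i @^-1` S).
Proof.
move=> mS; have eps_neq0 : eps != 0 by rewrite gt_eqF.
pose sc (v : borel R o) : borel R o := eps *: (v : 'rV[R]_o).
have msc : measurable_fun setT sc.
  apply: measurable_fun_borel => k.
  rewrite (_ : (fun v => _) = (fun v : borel R o => eps * (v : 'rV[R]_o) 0 k)).
    by apply: measurable_funM => //; exact: measurable_borel_coord.
  by apply/funext => v; rewrite mxE.
have mS' : measurable (sc @^-1` S) by rewrite -[X in measurable X]setTI; exact: msc.
have mS'' : measurable (@rV_opp R o @^-1` (sc @^-1` S)).
  by rewrite -[X in measurable X]setTI; exact: measurable_rV_opp.
have scK w : eps *: (eps^-1 *: (Z i w : 'rV[R]_o)) = Z i w.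
  by rewrite scalerA mulfV// scale1r.
have [_ stdZ] := gZ.
have := gauss_integral_opp mS'; rewrite -(stdZ i _ mS') -(stdZ i _ mS'').
rewrite (_ : (fun w => _) @^-1` (sc @^-1` S) = Z i @^-1` S); last first.
  by apply/seteqP; split=> w; rewrite /sc/= scK.
rewrite (_ : (fun w => _) @^-1` (_ @^-1` (sc @^-1` S)) = Z i @^-1` (@rV_opp R o @^-1` S))//.
by apply/seteqP; split=> w; rewrite /sc/rV_opp/= scalerN scK.
Qed.

(** By independence the law of the scalars <Z_i, g_i> factors on boxes, and each
    factor is invariant under reflection. *)
Lemma noise_sum_ge0 n (g : nat -> 'rV[R]_o) :
  ((1 / 2)%:E <= P [set w | 0 <= \sum_(i < n) dot2 (Z i w : 'rV[R]_o) (g i)]%R)%E.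
Proof.
pose dg i (z : borel R o) : R := dot2 (z : 'rV[R]_o) (g i).
have mdg i : measurable_fun setT (dg i).
  rewrite /dg /dot2; apply: measurable_sum => k.
  by apply: measurable_funM => //; exact: measurable_borel_coord.
have mdgS i (S : set R) : measurable S -> measurable (dg i @^-1` S).
  by move=> mS; rewrite -[X in measurable X]setTI; exact: mdg.
apply: (@symmetric_sum_ge0 R _ T P n (fun i w => dg i (Z i w))).
  by move=> i; apply: measurableT_comp => //; exact: mdg.
move=> A mA; have [indep _] := gZ.
(* [indep] expects sets indexed by all naturals; pad the family with setT. *)
pose A' i : set R := if (insub i : option 'I_n) is Some j then A j else setT.
have A'E (i : 'I_n) : A' i = A i by rewrite /A' valK.
have mA' i : measurable (A' i).
  by rewrite /A'; case: insub => [j|]; [exact: mA|exact: measurableT].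
have mN i : measurable (@rV_opp R o @^-1` (dg i @^-1` A' i)).
  by rewrite -[X in measurable X]setTI; apply: measurable_rV_opp => //; exact: mdgS.
have capE (F : nat -> set T) :
    \bigcap_(i in [set` iota 0 n]) F i = [set w | forall i : 'I_n, F i w].
  apply/seteqP; split=> w /= h i; first by apply: h; rewrite /= mem_iota/=.
  by move: h => /[swap]; rewrite /= mem_iota add0n => ni h; exact: (h (Ordinal ni)).
have e1 := indep (iota 0 n) (fun i => dg i @^-1` A' i) (iota_uniq _ _)
  (fun i => mdgS i _ (mA' i)).
have e2 := indep (iota 0 n) (fun i => @rV_opp R o @^-1` (dg i @^-1` A' i))
  (iota_uniq _ _) mN.
have E : P [set w | forall i : 'I_n, (Z i @^-1` (dg i @^-1` A' i)) w] =
    P [set w | forall i : 'I_n, (Z i @^-1` (@rV_opp R o @^-1` (dg i @^-1` A' i))) w].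
  rewrite !capE in e1 e2; apply: etrans e1 _; apply: etrans _ (esym e2).
  apply: eq_bigr => i _; apply/esym/noise_opp.
  by apply: mdgS; exact: mA'.
transitivity (P [set w | forall i : 'I_n, (Z i @^-1` (dg i @^-1` A' i)) w]).
  by congr (P _); apply/seteqP; split=> w /= h i; have := h i; rewrite /= A'E.
rewrite E; congr (P _); apply/seteqP; split=> w /= h i; have := h i; rewrite /= A'E.
all: suff -> : dg i (rV_opp (Z i w)) = - dg i (Z i w) by [].
all: by rewrite /dg /dot2 -sumrN; apply: eq_bigr => k _; rewrite mxE mulNr.
Qed.

End gaussian_symmetry.

Lemma measurable_noise_sum_ge0 (R : realType) o (disp : measure_display)
    (T : measurableType disp) (P : probability T R) (Z : nat -> {RV P >-> borel R o})
    n (g : nat -> 'rV[R]_o) :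
  measurable [set w | 0 <= \sum_(i < n) dot2 (Z i w : 'rV[R]_o) (g i)].
Proof.
pose S w := \sum_(i < n) dot2 (Z i w : 'rV[R]_o) (g i).
have mS : measurable_fun setT S.
  apply: measurable_sum => i; apply: measurable_sum => k.
  apply: measurable_funM => //.
  exact: (measurableT_comp (measurable_borel_coord k) (measurable_funP (Z i))).
rewrite (_ : mkset _ = setT `&` S @^-1` `[0, +oo[); first exact: mS.
by rewrite setTI; apply/seteqP; split=> w /=; rewrite in_itv/= andbT.
Qed.

(** * Euclidean norm, operator norm and diameter *)

Section euclidean_norm.
Context {R : realType}.

Lemma dot2_ge0 n (v : 'rV[R]_n) : 0 <= dot2 v v.
Proof. by apply: sumr_ge0 => i _; rewrite -expr2 sqr_ge0. Qed.

Lemma norm2_ge0 n (v : 'rV[R]_n) : 0 <= norm2 v.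
Proof. exact: sqrtr_ge0. Qed.

Lemma sqr_norm2 n (v : 'rV[R]_n) : norm2 v ^+ 2 = dot2 v v.
Proof. by rewrite sqr_sqrtr// dot2_ge0. Qed.

Lemma norm2Z n (c : R) (v : 'rV[R]_n) : norm2 (c *: v) = `|c| * norm2 v.
Proof.
rewrite /norm2 -sqrtr_sqr -sqrtrM ?sqr_ge0//; congr Num.sqrt.
by rewrite /dot2 mulr_sumr; apply: eq_bigr => i _; rewrite !mxE; ring.
Qed.

Lemma sqr_norm2B n (z g : 'rV[R]_n) :
  norm2 (z - g) ^+ 2 = norm2 z ^+ 2 - 2 * dot2 z g + norm2 g ^+ 2.
Proof.
rewrite !sqr_norm2 /dot2 mulr_sumr -sumrB -big_split/=.
by apply: eq_bigr => i _; rewrite !mxE; ring.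
Qed.

Lemma coord_le_norm2 n (v : 'rV[R]_n) i : `|v 0 i| <= norm2 v.
Proof.
rewrite -sqrtr_sqr /norm2 ler_sqrt ?dot2_ge0//.
by rewrite /dot2 (bigD1 i)//= -expr2 lerDl sumr_ge0// => j _; rewrite -expr2 sqr_ge0.
Qed.

Lemma norm_le_norm2 n (v : 'rV[R]_n) : `|v| <= norm2 v.
Proof.
apply: norm_le_coord; first exact: norm2_ge0.
by move=> i j; rewrite ord1 coord_le_norm2.
Qed.

Lemma norm2_delta_mx n (i : 'I_n) : norm2 (delta_mx 0 i : 'rV[R]_n) = 1.
Proof.
rewrite /norm2 /dot2 (bigD1 i)//= big1 => [|j ji]; rewrite !mxE !eqxx/=.
  by rewrite mulr1 addr0 sqrtr1.
by rewrite (negbTE ji) mulr0.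
Qed.

Lemma mxapp_ball2_bounded m n (M : 'M[R]_(m, n)) :
  has_ubound [set norm2 (mxapp M v) | v in ball2 1].
Proof.
exists (Num.sqrt (\sum_(i < m) (\sum_(j < n) `|M i j|) ^+ 2)) => _ [v v1 <-].
rewrite ler_sqrt; last by apply: sumr_ge0 => i _; rewrite sqr_ge0.
apply: ler_sum => i _; rewrite -expr2 -real_normK ?num_real// lerXn2r ?nnegrE//.
  by apply: sumr_ge0.
rewrite mxE; apply: le_trans (ler_norm_sum _ _ _) _; apply: ler_sum => j _.
rewrite mxE normrM ler_piMl// (le_trans (coord_le_norm2 _ _))//.
Qed.

Lemma norm2_0 n : norm2 (0 : 'rV[R]_n) = 0.
Proof. by rewrite /norm2 /dot2 big1 ?sqrtr0// => i _; rewrite mxE mul0r. Qed.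

Lemma norm2_mxapp m n (M : 'M[R]_(m, n)) v :
  norm2 (mxapp M v) <= opnorm2 M * norm2 v.
Proof.
have := norm2_ge0 v; rewrite le_eqVlt => /predU1P[v0|v0].
  have -> : v = 0.
    apply/rowP => i; rewrite mxE; apply/normr0_eq0/le_anti.
    by rewrite normr_ge0 andbT v0 coord_le_norm2.
  by rewrite /mxapp mul0mx !norm2_0 mulr0.
rewrite -(ler_pdivrMr _ _ v0) mulrC -[_^-1]ger0_norm ?invr_ge0 ?norm2_ge0//.
rewrite -norm2Z /mxapp scalemxAl; apply: ub_le_sup; first exact: mxapp_ball2_bounded.
exists ((norm2 v)^-1 *: v) => //=.
by rewrite /ball2/= norm2Z ger0_norm ?invr_ge0 ?norm2_ge0// mulVf// gt_eqF.
Qed.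

Lemma opnorm2_gt0 m n (M : 'M[R]_(m, n)) : M != 0 -> 0 < opnorm2 M.
Proof.
move=> /eqP M0; rewrite ltNge; apply/negP => M_le0; apply: M0.
apply/matrixP => i j; rewrite mxE; apply/normr0_eq0/le_anti.
rewrite normr_ge0 andbT; apply: le_trans M_le0.
have := norm2_mxapp M (delta_mx 0 j); rewrite norm2_delta_mx mulr1.
apply: le_trans; apply: le_trans (coord_le_norm2 _ i).
by rewrite /mxapp -rowE !mxE.
Qed.

End euclidean_norm.

Lemma norm2_eq0 (R : realType) n (v : 'rV[R]_n) : norm2 v = 0 -> v = 0.
Proof.
move=> v0; apply/rowP => i; rewrite mxE; apply/normr0_eq0/le_anti.
by rewrite normr_ge0 andbT -v0 coord_le_norm2.
Qed.

Lemma mxappB (R : realType) m n (M : 'M[R]_(m, n)) x y :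
  mxapp M (x - y) = mxapp M x - mxapp M y.
Proof. exact: mulmxBl. Qed.

Lemma diam2_ge (R : realType) n (S : set 'rV[R]_n) v w :
  S v -> S w -> ((norm2 (v - w))%:E <= diam2 S)%E.
Proof.
move=> Sv Sw; rewrite /diam2 le_max; apply/orP; right.
by apply: ereal_sup_ubound; exists (v, w).
Qed.

Lemma diam2_ge0 (R : realType) n (S : set 'rV[R]_n) : (0 <= diam2 S)%E.
Proof. by rewrite /diam2 le_max lexx. Qed.

(** * Likelihoods and filtering densities *)

Section likelihood.
Context {R : realType} {o : nat}.

Lemma noise_pdf_gt0 (eps : R) (z : 'rV[R]_o) : 0 < eps -> 0 < noise_pdf eps z.
Proof.
move=> eps0; rewrite mulr_gt0 ?invr_gt0 ?exprn_gt0// mulr_gt0 ?expR_gt0//.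
by rewrite invr_gt0 exprn_gt0// sqrtr_gt0 mulr_gt0 ?pi_gt0.
Qed.

Lemma noise_pdf_shift (eps : R) (z g : 'rV[R]_o) : 0 < eps ->
  noise_pdf eps (z - g) =
  noise_pdf eps z * expR ((2 * dot2 z g - norm2 g ^+ 2) / (2 * eps ^+ 2)).
Proof.
move=> eps0; rewrite /noise_pdf /gauss_pdf.
have -> : - (norm2 (eps^-1 *: (z - g)) ^+ 2 / 2) =
    - (norm2 (eps^-1 *: z) ^+ 2 / 2) + (2 * dot2 z g - norm2 g ^+ 2) / (2 * eps ^+ 2).
  rewrite !norm2Z !exprMn sqr_norm2B ger0_norm ?invr_ge0 ?ltW//.
  by field; rewrite gt_eqF.
by rewrite expRD !mulrA.
Qed.

Lemma likelihood_ratio n (eps : R) (z g : nat -> 'rV[R]_o) : 0 < eps ->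
  0 <= \sum_(i < n) dot2 (z i) (g i) ->
  \sum_(i < n) norm2 (g i) ^+ 2 <= eps ^+ 2 ->
  expR (- (1 / 2)) * \prod_(i < n) noise_pdf eps (z i) <=
  \prod_(i < n) noise_pdf eps (z i - g i).
Proof.
move=> eps0 zg gg; under [leRHS]eq_bigr do rewrite noise_pdf_shift//.
rewrite [leRHS]big_split/= -expR_sum mulrC ler_wpM2l//.
  by apply: prodr_ge0 => i _; exact/ltW/noise_pdf_gt0.
rewrite ler_expR -mulr_suml sumrB -mulr_sumr.
have e2 : 0 < eps ^+ 2 by rewrite exprn_gt0.
rewrite ler_pdivlMr ?mulr_gt0//.
set a := \sum_(i < n) _ in zg *; set b := \sum_(i < n) _ in gg *; lra.
Qed.

End likelihood.

Lemma right_inverse_eq (F : fieldType) (a b x y : F) :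
  a = b -> a * x = 1 -> b * y = 1 -> x = y.
Proof.
move=> -> bx by1; have b0 : b != 0.
  by apply: contra_eq_neq bx => ->; rewrite mul0r eq_sym oner_eq0.
by apply: (mulfI b0); rewrite bx.
Qed.

Lemma right_inverse_neq0 (F : fieldType) (b y : F) : b * y = 1 -> y != 0.
Proof.
by move=> by1; apply: contra_eq_neq by1 => ->; rewrite mulr0 eq_sym oner_eq0.
Qed.

Section posterior_ratio.
Context {R : realType} {d o : nat}.
Local Notation V := 'rV[R]_d.
Variables (A : {linear V -> V}) (B : {bilinear V -> V -> V}) (f : V).
Variables (r : R) (Psi : R -> V -> V) (h : R) (H : 'M[R]_(o, d)) (q : V -> R).
Hypotheses (flowP : is_flow A B f r Psi) (h0 : 0 < h).

Lemma filtering_weight_flow eps k y v : ball2 r v ->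
  filtering_weight Psi r h eps H q k y (Psi (k%:R * h) v) =
  \prod_(i < k.+1) noise_pdf eps (y i - mxapp H (Psi (i%:R * h) v)) *
  \det ('J (Psi (- (k%:R * h))) (Psi (k%:R * h) v)) * q v.
Proof.
move=> rv; have t0 : 0 <= k%:R * h by rewrite mulr_ge0// ltW.
rewrite /filtering_weight ifT; last by apply/mem_set; exists v.
by rewrite (flow_inverse flowP rv t0).
Qed.

(** The normalising constant and the Jacobian factor D cancel in the ratio.  The
    factor D is nonzero as the inverse of a Jacobian, and positive because a
    density is nonnegative. *)
Lemma filtering_density_ratio eps mu k (z : nat -> 'rV[R]_o) u v :
  0 < eps -> is_filtering_density Psi r h eps H q mu ->
  nbhs u (ball2 r : set V) -> nbhs v (ball2 r : set V) ->
  equi_jacobian_set Psi (k%:R * h) u v ->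
  0 < q u -> expR (- (1 / 2)) * q u <= q v ->
  0 <= \sum_(i < k.+1)
         dot2 (z i) (mxapp H (Psi (i%:R * h) v - Psi (i%:R * h) u)) ->
  \sum_(i < k.+1)
    norm2 (mxapp H (Psi (i%:R * h) v - Psi (i%:R * h) u)) ^+ 2 <= eps ^+ 2 ->
  let mu_y := mu k (fun i => mxapp H (Psi (i%:R * h) u) + z i) in
  0 < mu_y (Psi (k%:R * h) u) /\
  (expR 1)^-1 <= mu_y (Psi (k%:R * h) v) / mu_y (Psi (k%:R * h) u).
Proof.
move=> eps0 muP nu nv uvJ qu quv zg gg.
pose g i := mxapp H (Psi (i%:R * h) v - Psi (i%:R * h) u).
have {zg gg} := @likelihood_ratio _ _ k.+1 eps z g eps0 zg gg.
set pu := \prod_(i < k.+1) noise_pdf eps (z i); set pv := \prod_(i < k.+1) _.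
move=> puv mu_y.
have ru : ball2 r u by exact: nbhs_singleton.
have rv : ball2 r v by exact: nbhs_singleton.
have t0 : 0 <= k%:R * h := mulr_ge0 (ler0n _ _) (ltW h0).
have [[_ mu_ge0 _] [c c0 muE]] := muP k (fun i => mxapp H (Psi (i%:R * h) u) + z i).
pose D := \det ('J (Psi (- (k%:R * h))) (Psi (k%:R * h) u)).
have Ju := flow_jacobian_inverse flowP nu t0.
have Jv := flow_jacobian_inverse flowP nv t0.
pose Dv := \det ('J (Psi (- (k%:R * h))) (Psi (k%:R * h) v)).
have DvE : Dv = D := right_inverse_eq uvJ Jv Ju.
have D_neq0 : D != 0 := right_inverse_neq0 Ju.
have muu : mu_y (Psi (k%:R * h) u) = c * (pu * D * q u).
  apply: etrans (muE _) _; congr (c * _).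
  apply: etrans (filtering_weight_flow _ _ _ ru) _.
  have -> : \prod_(i < k.+1) noise_pdf eps (mxapp H (Psi (i%:R * h) u) + z i -
      mxapp H (Psi (i%:R * h) u)) = pu; last by [].
  by apply: eq_bigr => i _; rewrite addrAC subrr add0r.
have muv : mu_y (Psi (k%:R * h) v) = c * (pv * D * q v).
  apply: etrans (muE _) _; congr (c * _).
  apply: etrans (filtering_weight_flow _ _ _ rv) _; rewrite -DvE.
  have -> : \prod_(i < k.+1) noise_pdf eps (mxapp H (Psi (i%:R * h) u) + z i -
      mxapp H (Psi (i%:R * h) v)) = pv; last by [].
  by apply: eq_bigr => i _; congr noise_pdf; rewrite /g mxappB opprB addrAC addrC.
clear Ju Jv uvJ DvE muE; clearbody D pv.
have pu0 : 0 < pu by apply: prodr_gt0 => i _; exact: noise_pdf_gt0.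
have D0 : 0 < D.
  rewrite lt_neqAle eq_sym D_neq0/=.
  have := mu_ge0 (Psi (k%:R * h) u); rewrite -/mu_y muu pmulr_rge0// pmulr_lge0//.
  by rewrite pmulr_rge0.
have muu0 : 0 < mu_y (Psi (k%:R * h) u) by rewrite muu !mulr_gt0.
split=> //; rewrite ler_pdivlMr// muu muv mulrCA ler_wpM2l ?(ltW c0)//.
have -> : (expR 1)^-1 = expR (- (1 / 2)) * expR (- (1 / 2)) :> R.
  by rewrite -expRN -expRD; congr expR; lra.
have -> : expR (- (1 / 2)) * expR (- (1 / 2)) * (pu * D * q u) =
    (expR (- (1 / 2)) * pu) * D * (expR (- (1 / 2)) * q u) by ring.
have e0 := expR_ge0 (- (1 / 2) : R).
apply: ler_pM => //; rewrite ?mulr_ge0// ?(ltW pu0)// ?(ltW D0)// ?(ltW qu)//.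
by rewrite ler_wpM2r// ltW.
Qed.

End posterior_ratio.

(** * Lower bound on the expected diameter *)

(** As q vanishes outside the ball, positivity of q near u puts a neighbourhood
    of u inside the ball. *)
Lemma near_center_prior (R : realType) d (q : 'rV[R]_d -> R) (r c : R) (u : 'rV[R]_d) :
  (forall v, r < norm2 v -> q v = 0) -> {for u, continuous q} -> 0 < q u ->
  c < 1 ->
  exists2 rho : R, 0 < rho & forall v, `|v - u| < rho ->
    nbhs v (ball2 r : set 'rV[R]_d) /\ c * q u <= q v.
Proof.
move=> qout qcont qu c1.
have cqu : Num.max 0 (c * q u) < q u by rewrite gt_max qu/= gtr_pMl.
have /nbhs_ballP[rho /= rho0 qrho] : \forall v \near u, Num.max 0 (c * q u) < q v.
  exact: (cvgr_gt _ qcont).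
have qball v : ball u rho v -> 0 < q v /\ c * q u <= q v.
  by move=> /qrho/=; rewrite gt_max => /andP[? /ltW].
exists rho => // v vu; have uv : ball u rho v by rewrite -ball_normE/= distrC.
split; last by have [] := qball v uv.
have : nbhs v (ball u rho) by apply: open_nbhs_nbhs; split => //; exact: ball_open.
apply: filterS => w /qball[qw _]; rewrite /ball2/= leNgt.
by apply/negP => /qout qw0; rewrite qw0 ltxx in qw.
Qed.

Section lower_integral.
Local Open Scope ereal_scope.
Context d (T : measurableType d) (R : realType).

Import HBNNSimple.

(** Compare with s times the indicator of E: the integral of a nonnegative
    function is the supremum of the integrals of the simple functions below it. *)
Lemma cst_le_integral (mu : {measure set T -> \bar R}) (E : set T) (s : R)
    (f : T -> \bar R) :
  measurable E -> (0 <= s)%R -> (forall w, 0 <= f w) ->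
  (forall w, E w -> s%:E <= f w) -> s%:E * mu E <= \int[mu]_w f w.
Proof.
move=> mE s0 f0 sf; rewrite -integral_cst//= integral_mkcond.
have g0 w : 0 <= (cst s%:E \_ E) w by apply: erestrict_ge0 => ? _; rewrite lee_fin.
rewrite !ge0_integralTE//; apply: ereal_sup_le => _ [h hle <-]; exists h => //.
move=> w; apply: le_trans (hle w) _; rewrite /patch; case: ifPn => // /set_mem.
exact: sf.
Qed.

End lower_integral.

Theorem theorem3p5 (R : realType) (d o : nat)
    (A : {linear 'rV[R]_d -> 'rV[R]_d})
    (B : {bilinear 'rV[R]_d -> 'rV[R]_d -> 'rV[R]_d}) (f : 'rV[R]_d)
    (r delta : R) (Psi : R -> 'rV[R]_d -> 'rV[R]_d)
    (h : R) (H : 'M[R]_(o, d)) (q : 'rV[R]_d -> R) (u : 'rV[R]_d)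
    (U : nat -> set 'rV[R]_d) (C2 dmax : nat -> R) (C2u dmaxu : R)
    (idx : nat -> nat) :
  0 < r -> 0 < delta -> trapping_ball A B f r delta -> is_flow A B f r Psi ->
  0 < h -> H != 0 ->
  is_pdf q -> (forall v, r < norm2 v -> q v = 0) ->
  ball2 r u ->
  (forall k, U k `<=` equi_jacobian_set Psi (k%:R * h) u) ->
  (forall k, [set norm2 (Psi (k%:R * h) v - Psi (k%:R * h) u) | v in U k] =
             `[0, dmax k]%classic) ->
  (forall k v, U k v ->
     \sum_(i < k.+1) norm2 (Psi (i%:R * h) v - Psi (i%:R * h) u) ^+ 2
       <= C2 k * norm2 (Psi (k%:R * h) v - Psi (k%:R * h) u) ^+ 2) ->
  {homo idx : m n / (m < n)%N} ->
  (forall j, C2 (idx j) <= C2u) -> (forall j, dmaxu <= dmax (idx j)) ->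
  0 < dmaxu ->
  {for u, continuous q} ->
  (forall k v, U k v -> 0 < q v) ->
  exists2 eps0 : R, 0 < eps0 &
    forall (eps : R), 0 < eps < eps0 ->
    forall (disp : measure_display) (T : measurableType disp)
      (P : probability T R) (Z : nat -> {RV P >-> borel R o})
      (mu : nat -> (nat -> 'rV[R]_o) -> 'rV[R]_d -> R),
    gaussian_noise eps Z ->
    is_filtering_density Psi r h eps H q mu ->
    forall j : nat,
      (((2 * opnorm2 H * Num.sqrt C2u)^-1 * eps)%:E <=
       \int[P]_w diam2
         [set v | ((expR 1)^-1 <=
            mu (idx j) (fun i => mxapp H (Psi (i%:R * h) u) + Z i w) v /
            mu (idx j) (fun i => mxapp H (Psi (i%:R * h) u) + Z i w)
              (Psi ((idx j)%:R * h) u))%R])%E.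
Proof.
move=> _ _ _ flowP h0 H0 _ qout ru UJ Udist Usum _ C2le dmaxle dmaxu0 qcont Uq.
have rU k v : U k v -> ball2 r v.
  move=> /Uq qv; rewrite /ball2/= leNgt; apply/negP => /qout qv0.
  by rewrite qv0 ltxx in qv.
have t0 k : 0 <= k%:R * h := mulr_ge0 (ler0n _ _) (ltW h0).
have Upoint k s : 0 <= s <= dmax k ->
    exists2 v, U k v & norm2 (Psi (k%:R * h) v - Psi (k%:R * h) u) = s.
  move=> sd; have : `[0, dmax k]%classic s by rewrite /= in_itv.
  by rewrite -Udist => -[v Uv <-]; exists v.
(* The distance 0 is attained in U, and Psi is injective on the ball. *)
have uU : U (idx 0) u.
  have d0 : 0 <= dmax (idx 0) := le_trans (ltW dmaxu0) (dmaxle 0).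
  have [|v Uv /norm2_eq0/subr0_eq vu] := Upoint (idx 0) 0; first by rewrite lexx d0.
  suff <- : v = u by [].
  rewrite -(flow_inverse flowP (rU _ _ Uv) (t0 (idx 0))) vu.
  exact: (flow_inverse flowP ru (t0 (idx 0))).
have qu : 0 < q u := Uq _ _ uU.
(* The last term of the sum is the right-hand side itself, up to C2. *)
have C2u1 : 1 <= C2u.
  have [|v Uv vd] := Upoint (idx 0) dmaxu; first by rewrite ltW// dmaxle.
  have d2 : 0 < dmaxu ^+ 2 by rewrite exprn_gt0.
  have := Usum _ _ Uv; rewrite vd big_ord_recr/= vd => le1.
  have le2 : 1 * dmaxu ^+ 2 <= C2 (idx 0) * dmaxu ^+ 2.
    by apply: le_trans le1; rewrite mul1r lerDr sumr_ge0// => i _; exact: sqr_ge0.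
  by rewrite ler_pM2r// in le2; exact: le_trans le2 (C2le 0).
have sC0 : 0 < Num.sqrt C2u by rewrite sqrtr_gt0; lra.
have oH0 := opnorm2_gt0 H0.
have e12 : expR (- (1 / 2)) < 1 :> R by rewrite expR_lt1; lra.
have [rho rho0 rhoP] := near_center_prior qout qcont qu e12.
have eps00 : 0 < Num.min (dmaxu * (opnorm2 H * Num.sqrt C2u)) (rho * opnorm2 H).
  by rewrite lt_min !mulr_gt0.
(* The first bound ensures s <= dmaxu, the second |v - u| < rho. *)
exists (Num.min (dmaxu * (opnorm2 H * Num.sqrt C2u)) (rho * opnorm2 H)) => //.
move=> eps /andP[eps0]; rewrite lt_min => /andP[epsd epsrho].
move=> disp T P Z mu gZ muP j; set k := idx j.
pose s := eps / (opnorm2 H * Num.sqrt C2u).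
have oC0 : 0 < opnorm2 H * Num.sqrt C2u := mulr_gt0 oH0 sC0.
have s0 : 0 < s := divr_gt0 eps0 (mulr_gt0 oH0 sC0).
have sd : s <= dmaxu by rewrite ler_pdivrMr// ltW.
have [v Uv vs] : exists2 v, U k v & norm2 (Psi (k%:R * h) v - Psi (k%:R * h) u) = s.
  by apply: Upoint; rewrite (ltW s0)/= (le_trans sd (dmaxle j)).
pose D i := Psi (i%:R * h) v - Psi (i%:R * h) u.
have sumD : \sum_(i < k.+1) norm2 (D i) ^+ 2 <= (eps / opnorm2 H) ^+ 2.
  apply: le_trans (Usum _ _ Uv) _; rewrite vs.
  apply: (@le_trans _ _ (C2u * s ^+ 2)).
    by rewrite ler_wpM2r ?C2le// sqr_ge0.
  have -> : s = (Num.sqrt C2u)^-1 * (eps / opnorm2 H) by rewrite /s invfM mulrA mulrC.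
  rewrite exprMn exprVn sqr_sqrtr; last by lra.
  by rewrite mulrA mulfV ?mul1r//; apply: lt0r_neq0; lra.
have vu : `|v - u| < rho.
  apply: le_lt_trans (norm_le_norm2 _) _.
  apply: (@le_lt_trans _ _ (eps / opnorm2 H)); last by rewrite ltr_pdivrMr.
  rewrite -(@ler_pXn2r _ 2)// ?nnegrE ?norm2_ge0 ?divr_ge0 ?(ltW eps0) ?(ltW oH0)//.
  apply: le_trans sumD; rewrite big_ord_recl/= /D mul0r.
  rewrite (flow0 flowP (rU _ _ Uv)) (flow0 flowP ru) lerDl.
  by apply: sumr_ge0 => i _; exact: sqr_ge0.
have [nv quv] := rhoP v vu.
have /rhoP[nu _] : `|u - u| < rho by rewrite subrr normr0.
have sumHD : \sum_(i < k.+1) norm2 (mxapp H (D i)) ^+ 2 <= eps ^+ 2.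
  apply: (@le_trans _ _ (\sum_(i < k.+1) opnorm2 H ^+ 2 * norm2 (D i) ^+ 2)).
    apply: ler_sum => i _; rewrite -exprMn lerXn2r ?nnegrE ?norm2_ge0//.
      by rewrite mulr_ge0 ?norm2_ge0// ltW.
    exact: norm2_mxapp.
  rewrite -mulr_sumr; apply: (@le_trans _ _ (opnorm2 H ^+ 2 * (eps / opnorm2 H) ^+ 2)).
    by rewrite ler_wpM2l// sqr_ge0.
  by rewrite -exprMn mulrC divfK// lt0r_neq0.
pose E := [set w | 0 <= \sum_(i < k.+1) dot2 (Z i w : 'rV[R]_o) (mxapp H (D i))].
have PE : ((1 / 2)%:E <= P E)%E.
  exact: (@noise_sum_ge0 _ _ _ _ P eps Z eps0 gZ k.+1 (fun i => mxapp H (D i))).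
apply: (@le_trans _ _ (s%:E * P E)%E).
  apply: (@le_trans _ _ (s%:E * (1 / 2)%:E)%E); last first.
    by rewrite lee_pmul2l ?lte_fin.
  rewrite -EFinM lee_fin le_eqVlt; apply/orP; left; apply/eqP.
  by rewrite /s; field; rewrite !lt0r_neq0.
apply: cst_le_integral.
- exact: (@measurable_noise_sum_ge0 _ _ _ _ P Z k.+1 (fun i => mxapp H (D i))).
- exact: ltW.
- by move=> w; exact: diam2_ge0.
move=> w Ew; rewrite -vs.
have [mu0 ratio] := @filtering_density_ratio _ _ _ _ _ _ _ _ _ _ _ flowP h0 eps mu k
  (Z ^~ w) u v eps0 muP nu nv (UJ _ _ Uv) qu quv Ew sumHD.
apply: diam2_ge => /=; first exact: ratio.
rewrite divff ?lt0r_neq0// -expRN; apply/ltW; rewrite expR_lt1; lra.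
Qed.
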